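(* Let $\mathcal N$ be an infinite set of positive integers containing $1$, and define $$\Theta_{\mathcal N}:=\{\theta\in[-\pi,\pi]:\cos(n\theta)\ge0\text{ for every }n\in\mathcal N\},\qquad\beta_{\mathcal N}:=\max_{\theta\in\Theta_{\mathcal N}}|\theta|.$$ Let $X$ be a complex Banach space and let $T\in\mathcal B(X)$ satisfy $$\sup_{n\in\mathcal N}\|I-T^n\|\le1 .\qquad( * )$$ Then the following assertions hold. (1) The operator $T$ is sectorial of angle $\beta_{\mathcal N}$. More precisely, $$\sigma(T)\subset\{0\}\cup\{re^{i\theta}:0<r\le1,\ \theta\in\Theta_{\mathcal N}\},$$ and, writing $\Sigma_\omega:=\{z\in\mathbb C\setminus\{0\}:|\arg z|<\omega\}$ for $0<\omega<\pi$, $$\sup_{z\ne0,\ z\notin\Sigma_\omega}|z|\,\|(zI-T)^{-1}\|<\infty\qquad(\beta_{\mathcal N}<\omega<\pi).$$ (2) Suppose, in addition, that $$\lambda\in\mathbb T,\quad\sup_{n\in\mathcal N}|1-\lambda^n|\le\sqrt2\quad\Longrightarrow\quad\lambda=1 .\qquad( ** )$$ Then $T$ is sectorial of angle zero, $\sigma(T)\subset[0,1]$, and $$\sup_{m\ge1}\|I-T^m\|\le1 .$$ In particular, $T$ is a Ritt operator. (3) Condition $( ** )$ is compatible with unbounded quotients. For example, put $A_j=2^{2^j}$ for $j\ge1$ and $$\mathcal N=\{1\}\cup\bigcup_{j\ge1}\{A_j,A_j+1,\ldots,A_j+j\}.$$ Then this $\mathcal N$ satisfies $( ** )$, whereas its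 increasing enumeration $(n_k)_{k\ge0}$ satisfies $\sup_{k\ge0}n_{k+1}/n_k=\infty$. Consequently, there is a sequence $\mathcal N$ with unbounded quotients such that every bounded operator $T$ on a complex Banach space satisfying $( * )$ is Ritt.
   Context: $\mathbb D$ is the open unit disc, $\mathbb T$ the unit circle; $\arg z\in(-\pi,\pi]$ is the principal argument. No power boundedness of $T$ is assumed. A bounded operator $T$ is a Ritt operator if $\sigma(T)\subset\overline{\mathbb D}$ and $\sup_{|\lambda|>1}|\lambda-1|\,\|(\lambda-T)^{-1}\|<\infty$. A bounded operator $T$ is sectorial of angle $\beta\in[0,\pi)$ if $\sigma(T)\subset\overline{\Sigma_\omega}$ and $\sup_{z\neq0,\,z\notin\Sigma_\omega}|z|\,\|(zI-T)^{-1}\|<\infty$ for every $\omega\in(\beta,\pi)$. *)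

(* Defs.v *)
From HB Require Import structures.
From mathcomp Require Import all_boot all_order all_algebra.
From mathcomp Require Import all_classical all_reals all_analysis.
From mathcomp Require Export complex.
Set Implicit Arguments.
Unset Strict Implicit.
Unset Printing Implicit Defensive.
Import Order.TTheory GRing.Theory Num.Theory.
Import numFieldNormedType.Exports.
Local Open Scope classical_set_scope.
Local Open Scope complex_scope.
Local Open Scope ring_scope.

Definition cis {R : realType} (theta : R) : R[i] := cos theta +i* sin theta.

(* The principal argument, with values in ]-pi, pi]. Its value at 0 is
   irrelevant. *)
Definition arg {R : realType} (z : R[i]) : R :=
  let phi := acos (complex.Re z / complex.Re `|z|) in
  if 0 <= complex.Im z then phi else - phi.

Lemma argP (R : realType) (z : R[i]) : z != 0 ->
  - pi < arg z <= pi /\ z = `|z| * cis (arg z).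
Proof.
case: z => a b z0; rewrite /arg /cis normc_def /=.
set s := a ^+ 2 + b ^+ 2.
have s_gt0 : 0 < s.
  rewrite lt_neqAle addr_ge0 ?sqr_ge0// andbT eq_sym paddr_eq0 ?sqr_ge0//.
  by rewrite !sqrf_eq0; apply: contra z0 => /andP[/eqP-> /eqP->].
set r := Num.sqrt s.
have r_gt0 : 0 < r by rewrite sqrtr_gt0.
have r2 : r ^+ 2 = s by rewrite sqr_sqrtr// ltW.
have q2 : (a / r) ^+ 2 <= 1.
  by rewrite expr_div_n r2 ler_pdivrMr// mul1r lerDl sqr_ge0.
have q1 : -1 <= a / r <= 1.
  by rewrite -ler_norml -(@ler_pXn2r _ 2) ?nnegrE// expr1n real_normK// num_real.
have ca : r * cos (acos (a / r)) = a.
  by rewrite acosK ?in_itv//= mulrC divfK// gt_eqF.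
have sa : r * sin (acos (a / r)) = `|b|.
  rewrite sin_acos// -sqrtr_sqr -[X in X * _]gtr0_norm// -[X in X * _]sqrtr_sqr.
  rewrite -sqrtrM ?sqr_ge0// mulrBr mulr1 expr_div_n r2 mulrC divfK ?gt_eqF//.
  by rewrite /s addrC addKr.
have a0 : 0 <= acos (a / r) by rewrite acos_ge0.
have api : acos (a / r) <= pi by rewrite acos_lepi.
case: ifPn => [b0|]; [|rewrite -ltNge => b0]; split.
- by rewrite api andbT (lt_le_trans _ a0)// oppr_lt0 pi_gt0.
- by simpc; rewrite ca sa ger0_norm.
- rewrite (le_trans (y := 0)) ?oppr_le0 ?pi_ge0// andbT ltrN2.
  rewrite lt_neqAle api andbT; apply/eqP => e.
  by move: sa; rewrite e sinpi mulr0 => /esym/normr0P/eqP b_eq; rewrite b_eq ltxx in b0.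
- by simpc; rewrite cosN sinN mulrN ca sa ltr0_norm// opprK.
Qed.

Definition sector {R : realType} (omega : R) : set R[i] :=
  [set z | z != 0 /\ `|arg z| < omega].

Section Operators.
Context {R : realType} {X : normedModType R[i]}.
Implicit Types (T S : {linear X -> X}).

(* The norm of X takes its values in R[i]; its real part is the same number seen
   in R. The supremum is meaningful for bounded f only: below, f is always
   linear and continuous. *)
Definition opnorm (f : X -> X) : R :=
  sup [set complex.Re `|f x| | x in [set x : X | `|x| <= 1]].

Definition is_resolvent T (z : R[i]) S :=
  [/\ continuous S,
      forall x, z *: S x - T (S x) = x &
      forall x, S (z *: x - T x) = x].

Definition spectrum T : set R[i] :=
  [set z | ~ exists S, is_resolvent T z S].

(* On A the resolvent exists and sup_(z in A) |w z| ||(z I - T)^-1|| < oo. *)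
Definition resolvent_bounded_on T (A : set R[i]) (w : R[i] -> R[i]) :=
  exists M : R, forall z, A z ->
    exists2 S, is_resolvent T z S & complex.Re `|w z| * opnorm S <= M.

Definition sectorial T (beta : R) :=
  0 <= beta < pi /\
  forall omega, beta < omega < pi ->
    spectrum T `<=` closure (sector omega : set (R[i] : numFieldType)) /\
    resolvent_bounded_on T [set z | z != 0 /\ ~ sector omega z] id.

Definition Ritt T :=
  spectrum T `<=` [set z | `|z| <= 1] /\
  resolvent_bounded_on T [set z | 1 < `|z|] (fun z => z - 1).

(* sup_(n in N) ||I - T^n|| <= 1 *)
Definition unit_distance (N : set nat) T :=
  forall n, N n -> opnorm (fun x => x - iter n T x) <= 1.

End Operators.

Definition index_set (N : set nat) :=
  [/\ infinite_set N, N 1%N & forall n, N n -> (0 < n)%N].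

Section IndexSets.
Context {R : realType}.
Implicit Types N : set nat.

Definition Theta N : set R :=
  [set theta | - pi <= theta <= pi /\
     forall n, N n -> 0 <= cos (n%:R * theta)].

Definition betaN N : R := sup [set `|theta| | theta in Theta N].

Lemma betaN_max N :
  (exists2 theta, Theta N theta & `|theta| = betaN N) /\
  (forall theta, Theta N theta -> `|theta| <= betaN N).
Proof.
have Theta0 : Theta N 0.
  split=> [|n _]; first by rewrite oppr_le0 pi_ge0.
  by rewrite mulr0 cos0.
have cT : compact (Theta N).
  have -> : Theta N = `[- pi, pi]%classic `&`
      \bigcap_(n in N) ((fun t : R => cos (n%:R * t)) @^-1` [set x | 0 <= x]).
    by apply/seteqP; split=> t /=; rewrite /Theta /= in_itv.
  apply: (@subclosed_compact _ _ `[- pi, pi]%classic).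
  - apply: closedI; first exact: itv_closed.
    apply: closed_bigI => n _; apply: preimage_closed => [t _|]; last exact: closed_ge.
    apply: continuous_comp; last exact: continuous_cos.
    by apply: mulrl_continuous.
  - exact: segment_compact.
  - by move=> t [].
have [t Tt tmax] : exists2 t, Theta N t & forall s, Theta N s -> `|s| <= `|t|.
  have := @compact_EVT_max _ _ (fun t : R => `|t|) (Theta N).
  move=> /(_ (ex_intro _ _ Theta0) cT); case.
    by apply: continuous_subspaceT => x; exact: norm_continuous.
  by move=> t /set_mem Tt h; exists t => // s Ts; apply: h; rewrite inE.
have ubT : has_ubound [set `|theta| | theta in Theta N].
  by exists `|t| => _ [s Ts <-]; exact: tmax.
split=> [|s Ts]; last by apply: ub_le_sup => //; exists s.
exists t => //; apply/eqP; rewrite eq_le; apply/andP; split.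
  by apply: ub_le_sup => //; exists t.
by apply: ge_sup; [exists `|t|, t | move=> _ [s Ts <-]; exact: tmax].
Qed.

Definition separating N :=
  forall lambda : R[i], `|lambda| = 1 ->
    (forall n, N n -> `|1 - lambda ^+ n| <= (Num.sqrt 2)%:C) ->
    lambda = 1.

Definition unbounded_quotients N :=
  exists e : nat -> nat,
    [/\ {homo e : i j / (i < j)%N}, range e = N &
        ereal_sup (range (fun k => ((e k.+1)%:R / (e k)%:R : R)%:E)) = +oo%E].

End IndexSets.

Definition blocks : set nat :=
  [set 1%N] `|`
  \bigcup_(j in [set j | (1 <= j)%N])
    [set n | (2 ^ (2 ^ j) <= n <= 2 ^ (2 ^ j) + j)%N].

(* Main.v *)
Require Import Defs.
From HB Require Import structures.
From mathcomp Require Import all_boot all_order all_algebra.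
From mathcomp Require Import all_classical all_reals all_analysis.
From mathcomp Require Import ring lra zify.
Set Implicit Arguments.
Unset Strict Implicit.
Unset Printing Implicit Defensive.
Import Order.TTheory GRing.Theory Num.Theory.
Import numFieldNormedType.Exports.
Local Open Scope classical_set_scope.
Local Open Scope complex_scope.
Local Open Scope ring_scope.

(** Everything rests on estimates of the form [c |z| |x| <= |z x - T x|]: once
    [z - T] is known to be onto, such an estimate makes it invertible and bounds
    the inverse ([resolvent_of_surjective]).

    Sectoriality. If [|I - T^n| <= 1] and [|z^n - 1| > 1], then [z^n - T^n] is
    invertible by the Neumann series, and [z - T] divides it
    ([resolvent_exists]); this locates the spectrum. For [z = r e^(i t)] with
    [cos (n t) <= -d < 0] one has [|z^n - 1| - 1 >= d r^n]. The inverse of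
    [z - T] is then the sum over [k < n] of the [z^(n-1-k) T^k (z^n - T^n)^-1].
    Here [T^k (z^n - T^n)^-1] has the right size [r^(k-n)] for [k = 0] and for
    [k = n], also as [r -> 0]. The intermediate
    ones follow by interpolation, because [|I - T| <= 1] makes [T] accretive and
    an accretive operator satisfies Landau's inequality ([landau],
    [sectorial_bound]). Compactness of the set of directions at distance from
    [Theta N] gives uniformity ([sector_lower_bound]).

    Separating sets. Then [Theta N] is reduced to [0], so [T] has angle zero, and
    it suffices to see that [T^m = (T^n)^(m/n)] for [m <= n] with [n] in [N],
    where the fractional power is the sum of the binomial series in [I - T^n]:
    the coefficients of this series add up to zero and only the constant one,
    which is [1], is positive, so [|I - (T^n)^(m/n)| <= 1]
    ([accretive_root]). Let [U = (T^n)^(1/n)]; then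
    [U^n = T^n], and [|I - U^k| <= 1] for all [k <= n]. If [w] is a nontrivial
    [n]-th root of unity, then on the kernel of [U - w T] the resolvent of [T]
    is that of a rotation of [U]; some [k <= n] has [Re w^k < 0], so it is
    bounded by [C / |z|] near the positive half-line, and as [T] has angle zero
    it is so at every [z != 0]. A Liouville argument then shows that [T] vanishes
    there ([liouville], [eigenvector_kernel]). Fourier analysis on the cyclic
    group of order [n] deduces [T (U - T) = 0], and [U = T] since the kernel and
    the closed range of an accretive operator meet only in [0]
    ([accretive_root_unique]).

    The Ritt condition. For [|z| > 1] with small argument [t], choose [m] such
    that [m t] is close to [pi] and use [|I - T^m| <= 1] once more: as [T] is
    power bounded and [m] is of the order of [1 / |t|], this controls
    [|t| |(z - T)^-1|], while power boundedness alone controls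
    [(|z| - 1) |(z - T)^-1|] ([angular_lower], [radial_lower]).

    The blocks. If [lambda] is unimodular and not [1] or [-1], the numbers
    [Re (lambda^n)] cannot stay nonnegative along arbitrarily long intervals
    ([nonneg_run_bounded]), whereas the blocks have unbounded length; [-1] is
    excluded by [1] being in the set. *)

(** * Real-valued norms *)
Section ComplexModulus.
Variable R : realType.
Implicit Types (z w : R[i]) (a b : R).

Lemma rcD a b : (a + b)%:C = a%:C + b%:C.
Proof. exact: rmorphD. Qed.

Lemma rcM a b : (a * b)%:C = a%:C * b%:C.
Proof. exact: rmorphM. Qed.

Lemma rcX a n : (a ^+ n)%:C = a%:C ^+ n.
Proof. exact: rmorphXn. Qed.

Lemma rcV a : (a^-1)%:C = (a%:C)^-1.
Proof. exact: fmorphV. Qed.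

(** The norm of [R[i]] takes its values in [R[i]]; estimates and orders are handled
    in [R]. *)
Definition cabs z : R := complex.Re `|z|.

Lemma cabsE z : `|z| = (cabs z)%:C.
Proof. by []. Qed.

Lemma cabs_ge0 z : 0 <= cabs z.
Proof. by have := normr_ge0 z; rewrite cabsE lecR. Qed.

Lemma cabsM z w : cabs (z * w) = cabs z * cabs w.
Proof. by apply/complexI; rewrite rcM -!cabsE normrM. Qed.

Lemma cabsX z n : cabs (z ^+ n) = cabs z ^+ n.
Proof. by apply/complexI; rewrite rcX -!cabsE normrX. Qed.

Lemma cabsN z : cabs (- z) = cabs z.
Proof. by rewrite /cabs normrN. Qed.

Lemma cabs1 : cabs 1 = 1.
Proof. by rewrite /cabs normr1. Qed.

Lemma cabsD z w : cabs (z + w) <= cabs z + cabs w.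
Proof. by rewrite -lecR rcD -!cabsE ler_normD. Qed.

Lemma cabsB z w : cabs (z - w) <= cabs z + cabs w.
Proof. by rewrite -(cabsN w) cabsD. Qed.

Lemma cabs_real a : cabs a%:C = `|a|.
Proof. by apply/complexI; rewrite -cabsE normc_def /= expr0n /= addr0 sqrtr_sqr. Qed.

Lemma cabs_eq0 z : (cabs z == 0) = (z == 0).
Proof. by rewrite -[RHS]normr_eq0 cabsE -(inj_eq (@complexI R)). Qed.

Lemma cabs_gt0 z : (0 < cabs z) = (z != 0).
Proof. by rewrite lt_def cabs_ge0 andbT cabs_eq0. Qed.

Lemma cabs_sqr z : cabs z ^+ 2 = complex.Re z ^+ 2 + complex.Im z ^+ 2.
Proof. by rewrite /cabs normc_def /= sqr_sqrtr // addr_ge0 ?sqr_ge0. Qed.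

Lemma cabsV z : cabs z^-1 = (cabs z)^-1.
Proof. by apply/complexI; rewrite rcV -!cabsE normfV. Qed.

End ComplexModulus.

Section RealNorm.
Variable R : realType.
Variable X : normedModType R[i].
Implicit Types (x y : X) (z : R[i]) (T : {linear X -> X}).

Definition nrm x : R := complex.Re `|x|.

Lemma nrmE x : `|x| = (nrm x)%:C.
Proof.
have := normr_ge0 x; rewrite /nrm; case: `|x| => a b.
by rewrite lecE /= => /andP[/eqP-> _].
Qed.

Lemma nrm_ge0 x : 0 <= nrm x.
Proof. by have := normr_ge0 x; rewrite nrmE lecR. Qed.

Lemma nrmD x y : nrm (x + y) <= nrm x + nrm y.
Proof. by rewrite -lecR rcD -!nrmE ler_normD. Qed.

Lemma nrmN x : nrm (- x) = nrm x.
Proof. by rewrite /nrm normrN. Qed.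

Lemma nrmB x y : nrm (x - y) <= nrm x + nrm y.
Proof. by rewrite -(nrmN y) nrmD. Qed.

Lemma nrm_distC x y : nrm (x - y) = nrm (y - x).
Proof. by rewrite -nrmN opprB. Qed.

Lemma nrmZ z x : nrm (z *: x) = cabs z * nrm x.
Proof. by apply/complexI; rewrite rcM -[LHS](nrmE (z *: x)) normrZ nrmE cabsE. Qed.

Lemma nrm0 : nrm 0 = 0.
Proof. by rewrite /nrm normr0. Qed.

Lemma nrm_eq0 x : nrm x = 0 -> x = 0.
Proof. by move=> h; apply/eqP; rewrite -normr_eq0 nrmE h. Qed.

Lemma nrm_le0 x : nrm x <= 0 -> x = 0.
Proof. by move=> h; apply: nrm_eq0; apply: le_anti; rewrite h nrm_ge0. Qed.

Lemma nrm_lerB x y : nrm x - nrm y <= nrm (x - y).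
Proof. by rewrite lerBlDr -{1}(subrK y x) nrmD. Qed.

Lemma nrm_sum (I : Type) (r : seq I) (P : pred I) (F : I -> X) :
  nrm (\sum_(i <- r | P i) F i) <= \sum_(i <- r | P i) nrm (F i).
Proof.
elim/big_ind2: _ => [|x1 a x2 b h1 h2|i _]; rewrite ?nrm0//.
by rewrite (le_trans (nrmD _ _))// lerD.
Qed.

Lemma nrm_small x (C : R) :
  (forall e : R, 0 < e -> nrm x <= C * e) -> x = 0.
Proof.
move=> h; apply: nrm_le0; apply/ler_addgt0Pr => e e0; rewrite add0r.
have c0 : 0 < `|C| + 1 by rewrite ltr_wpDl.
apply: (le_trans (h (e / (`|C| + 1)) _)); first by rewrite divr_gt0.
rewrite mulrCA -[leRHS]mulr1 ler_wpM2l ?(ltW e0)// ler_pdivrMr// mul1r.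
by rewrite (le_trans (ler_norm C))// lerDl.
Qed.

Definition bounded_by (f : X -> X) (M : R) := forall x, nrm (f x) <= M * nrm x.

Lemma continuous_boundedP T : continuous T <-> exists2 M, 0 <= M & bounded_by T M.
Proof.
split=> [cT|[M M0 hM]].
- have /linear_boundedP/pinfty_ex_gt0[r r0 hr] :=
    (linear_bounded_continuous T).2 cT.
  have rR : r = (complex.Re r)%:C.
    by move: r0; rewrite ltcE /=; case: (r) => a b /= /andP[/eqP-> _].
  exists (complex.Re r); first by move: r0; rewrite rR ltcR => /ltW.
  by move=> x; rewrite -lecR rcM -rR -!nrmE.
- apply: (linear_bounded_continuous T).1; apply/linear_boundedP.
  exists M%:C; split; first by apply: ger0_real; rewrite lecR.
  move=> r Mr x; rewrite (le_trans (_ : _ <= M%:C * `|x|))//.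
    by rewrite !nrmE -rcM lecR.
  by rewrite ler_wpM2r// ltW.
Qed.

Lemma opnorm_le T (M : R) : 0 <= M -> bounded_by T M -> opnorm T <= M.
Proof.
move=> M0 hM; apply: ge_sup; first by exists (complex.Re `|T 0|), 0 => //=; rewrite normr0.
move=> _ [x /= x1 <-]; apply: (le_trans (hM x)); rewrite -[leRHS]mulr1 ler_wpM2l//.
by rewrite -lecR -nrmE.
Qed.

(** The supremum [opnorm f] is meaningful only for bounded [f], hence the
    auxiliary bound [C]; homogeneity then spreads the bound from the unit ball
    to the whole space. *)
Lemma opnorm_bounded (f : X -> X) (M C : R) :
  (forall (a : R[i]) x, f (a *: x) = a *: f x) -> bounded_by f C ->
  opnorm f <= M -> bounded_by f M.
Proof.
move=> fZ hC fM x; have [x0|x0] := eqVneq (nrm x) 0.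
  by rewrite (nrm_eq0 x0) -[X in f X](scale0r (0 : X)) fZ scale0r nrm0 mulr0.
have xp : 0 < nrm x by rewrite lt_def x0 nrm_ge0.
have : nrm (f (((nrm x)^-1)%:C *: x)) <= M.
  apply: le_trans fM; apply: ub_le_sup; last first.
    exists (((nrm x)^-1)%:C *: x) => //=.
    by rewrite nrmE nrmZ cabs_real ger0_norm ?invr_ge0 ?nrm_ge0// mulVf.
  exists `|C| => _ [y /= y1 <-]; apply: (le_trans (hC y)).
  have {}y1 : nrm y <= 1 by rewrite -lecR -nrmE.
  apply: (le_trans (y := `|C| * nrm y)).
    by rewrite ler_wpM2r ?nrm_ge0// ler_norm.
  by rewrite -[leRHS]mulr1 ler_wpM2l.
by rewrite fZ nrmZ cabs_real ger0_norm ?invr_ge0 ?nrm_ge0// ler_pdivrMl// mulrC.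
Qed.

Lemma iter_linear T n : linear (iter n T).
Proof. by move=> a x y; elim: n => //= n ->; rewrite linearP. Qed.

Lemma iterZ T n a x : iter n T (a *: x) = a *: iter n T x.
Proof. by elim: n => //= n ->; rewrite linearZ. Qed.

Lemma bounded_iter T M n : 0 <= M -> bounded_by T M -> bounded_by (iter n T) (M ^+ n).
Proof.
move=> M0 hM x; elim: n => [|n IH] /=; first by rewrite expr0 mul1r.
by rewrite (le_trans (hM _))// exprS -mulrA ler_wpM2l.
Qed.

Lemma unit_distanceP (N : set nat) T : continuous T ->
  unit_distance N T <->
  forall n, N n -> forall x, nrm (x - iter n T x) <= nrm x.
Proof.
move=> /continuous_boundedP[M M0 hM]; split=> hT n Nn.
- move=> x; rewrite -[leRHS]mul1r; move: x.
  apply: (@opnorm_bounded (fun x => x - iter n T x) 1 (1 + M ^+ n)); last exact: hT.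
    by move=> a x; rewrite scalerBr iterZ.
  move=> x; apply: (le_trans (nrmB _ _)); rewrite mulrDl mul1r lerD2l.
  exact: bounded_iter.
- apply: ge_sup; first by exists (complex.Re `|0 - iter n T 0|), 0 => //=; rewrite normr0.
  move=> _ [x /= x1 <-]; apply: (le_trans (hT n Nn x)).
  by rewrite -lecR -nrmE.
Qed.

End RealNorm.

(** * Polynomials in an operator, completeness and resolvents *)
Section Polynomials.
Variables (R : realType) (X : normedModType R[i]) (T : {linear X -> X}).
Implicit Types (p q : {poly R[i]}) (x : X).

Definition pol p x : X := \sum_(i < size p) p`_i *: iter i T x.

Lemma pol_wide p n x : (size p <= n)%N ->
  pol p x = \sum_(i < n) p`_i *: iter i T x.
Proof.
move=> pn; rewrite /pol (big_ord_widen n (fun i => p`_i *: iter i T x))// big_mkcond.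
apply: eq_bigr => i _; case: ifPn => // ; rewrite -leqNgt => h.
by rewrite nth_default// scale0r.
Qed.

Lemma polD p q x : pol (p + q) x = pol p x + pol q x.
Proof.
rewrite !(@pol_wide _ (maxn (size p) (size q))) ?leq_maxl ?leq_maxr ?size_polyD//.
by rewrite -big_split; apply: eq_bigr => i _; rewrite coefD scalerDl.
Qed.

Lemma polZ a p x : pol (a *: p) x = a *: pol p x.
Proof.
rewrite (@pol_wide _ (size p)) ?size_scale_leq// /pol scaler_sumr.
by apply: eq_bigr => i _; rewrite coefZ scalerA.
Qed.

Lemma polN p x : pol (- p) x = - pol p x.
Proof. by rewrite -scaleN1r polZ scaleN1r. Qed.

Lemma polB p q x : pol (p - q) x = pol p x - pol q x.
Proof. by rewrite polD polN. Qed.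

Lemma polC a x : pol a%:P x = a *: x.
Proof. by rewrite (@pol_wide _ 1) ?size_polyC_leq1// big_ord1 coefC eqxx. Qed.

Lemma pol_mulX p x : pol (p * 'X) x = pol p (T x).
Proof.
rewrite (@pol_wide _ (size p).+1); last first.
  by rewrite (leq_trans (size_polyMleq _ _))// size_polyX addn2.
rewrite big_ord_recl coefMX eqxx scale0r add0r; apply: eq_bigr => i _.
by rewrite coefMX lift0 -iterSr.
Qed.

Lemma pol_comm p x : T (pol p x) = pol p (T x).
Proof.
by rewrite linear_sum; apply: eq_bigr => i _; rewrite linearZ /= -iterSr.
Qed.

Lemma pol_is_linear p : linear (pol p).
Proof.
move=> a x y; rewrite /pol scaler_sumr -big_split; apply: eq_bigr => i _ /=.
by rewrite iter_linear scalerDr !scalerA mulrC.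
Qed.

Lemma polM p q x : pol (p * q) x = pol p (pol q x).
Proof.
elim/poly_ind: p x => [|p c IH] x; first by rewrite mul0r /pol size_poly0 !big_ord0.
rewrite mulrDl !polD mul_polyC polZ polC -mulrA ['X * q]mulrC mulrA !pol_mulX IH.
by rewrite pol_comm.
Qed.

Lemma polXn n x : pol 'X^n x = iter n T x.
Proof.
elim: n x => [|n IH] x; first by rewrite expr0 -polyC1 polC scale1r.
by rewrite exprSr pol_mulX IH iterSr.
Qed.

Lemma pol_sum (I : Type) (r : seq I) (P : pred I) (F : I -> {poly R[i]}) x :
  pol (\sum_(i <- r | P i) F i) x = \sum_(i <- r | P i) pol (F i) x.
Proof.
elim/big_ind2: _ => [|p1 a p2 b h1 h2|i _] //; last by rewrite polD h1 h2.
by rewrite /pol size_poly0 big_ord0.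
Qed.

End Polynomials.

Section Factorization.
Variables (R : realType) (X : normedModType R[i]) (T : {linear X -> X}).
Implicit Types (x y : X) (z : R[i]).

(** The cofactor of [z - T] in [z^n - T^n]. *)
Definition geom z n x : X := \sum_(i < n) z ^+ (n.-1 - i) *: iter i T x.

Lemma geomE z n x :
  geom z n x = pol T (\sum_(i < n) z%:P ^+ (n.-1 - i) * 'X^i) x.
Proof.
rewrite pol_sum; apply: eq_bigr => i _.
by rewrite -rmorphXn mul_polyC polZ polXn.
Qed.

Lemma resolvent_pol z x : z *: x - T x = pol T (z%:P - 'X) x.
Proof. by rewrite polB polC -['X]expr1 polXn. Qed.

Lemma power_pol z n x : z ^+ n *: x - iter n T x = pol T (z%:P ^+ n - 'X^n) x.
Proof. by rewrite polB -rmorphXn polC polXn. Qed.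

Lemma sub_powerl z n x :
  z ^+ n *: x - iter n T x = z *: geom z n x - T (geom z n x).
Proof.
case: n => [|n]; first by rewrite /geom big_ord0 scale1r subrr scaler0 linear0 subrr.
by rewrite resolvent_pol geomE -polM power_pol subrXX.
Qed.

Lemma sub_powerr z n x :
  z ^+ n *: x - iter n T x = geom z n (z *: x - T x).
Proof.
case: n => [|n]; first by rewrite /geom big_ord0 scale1r subrr.
by rewrite resolvent_pol geomE -polM power_pol subrXX mulrC.
Qed.

End Factorization.

Section Completeness.
Variables (R : realType) (X : completeNormedModType R[i]).
Implicit Types (x y : X).

(** The norm of [X] takes its values in [R[i]], so the Cauchy criterion is restated
    with a real tolerance. *)
Lemma nrm_complete (u : nat -> X) :
  (forall e : R, 0 < e ->
    exists K, forall m n, (K <= m)%N -> (K <= n)%N -> nrm (u m - u n) <= e) ->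
  exists l, forall e : R, 0 < e ->
    exists K, forall n, (K <= n)%N -> nrm (u n - l) <= e.
Proof.
move=> hu; have /cvg_ex[l hl] : cvgn u.
  apply: cauchy_cvg; apply: cauchy_exP => e e0.
  have eR : e = (complex.Re e)%:C.
    by move: e0; rewrite ltcE /=; case: (e) => a b /= /andP[/eqP-> _].
  have r0 : 0 < complex.Re e by move: e0; rewrite {1}eR ltcR.
  have [|K hK] := hu (complex.Re e / 2); first by rewrite divr_gt0.
  exists (u K); exists K => //= n Kn; rewrite /= -ball_normE /ball_ /=.
  rewrite nrmE eR ltcR (le_lt_trans (hK _ _ (leqnn K) Kn))//.
  by rewrite ltr_pdivrMr// ltr_pMr// ltr1n.
exists l => e e0; move/cvgrPdist_lt: hl => /(_ e%:C); rewrite ltcR => /(_ e0).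
move=> [K _ hK]; exists K => n Kn; have := hK n Kn.
by rewrite /= nrmE ltcR nrm_distC => /ltW.
Qed.

Lemma contraction_fixpoint (f : X -> X) (q : R) :
  0 <= q < 1 -> (forall x y, nrm (f x - f y) <= q * nrm (x - y)) ->
  exists x, f x = x.
Proof.
move=> /andP[q0 q1] hf; pose u n := iter n f 0; pose d := nrm (f 0 - 0 : X).
have du n : nrm (u n.+1 - u n) <= q ^+ n * d.
  elim: n => [|n IH]; first by rewrite expr0 mul1r.
  by rewrite (le_trans (hf _ _))// exprS -mulrA ler_wpM2l.
have q1' : 0 < 1 - q by rewrite subr_gt0.
have d0 : 0 <= d by exact: nrm_ge0.
have dn n k : nrm (u (n + k)%N - u n) <= q ^+ n * (d / (1 - q)).
  rewrite (le_trans (_ : _ <= q ^+ n * (d * \sum_(i < k) q ^+ i)))//.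
    elim: k => [|k IH]; first by rewrite addn0 subrr nrm0 big_ord0 !mulr0.
    rewrite -(subrKA (u (n + k)%N)) (le_trans (nrmD _ _))// big_ord_recr /=.
    rewrite !mulrDr addrC lerD// addnS (le_trans (du _))//.
    by rewrite exprD -mulrA [d * _]mulrC.
  rewrite ler_wpM2l ?exprn_ge0// ler_wpM2l// -[leRHS]mul1r ler_pdivlMr// mulrC.
  by rewrite -[1 - q]opprB mulNr -subrX1 opprB lerBlDr lerDl exprn_ge0.
have [l hl] : exists l, forall e : R, 0 < e ->
    exists K, forall n, (K <= n)%N -> nrm (u n - l) <= e.
  apply: nrm_complete => e e0.
  have [K hK] : exists K, q ^+ K * (d / (1 - q)) <= e / 2.
    have := @cvg_expr R q; rewrite ger0_norm// => /(_ q1) /cvgrPdist_lt.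
    have c0 : 0 < 1 + d / (1 - q) by rewrite ltr_pwDl// divr_ge0// ltW.
    move=> /(_ (e / 2 / (1 + d / (1 - q)))) [|K _ /(_ K (leqnn K))].
      by rewrite !divr_gt0.
    rewrite /= sub0r normrN ger0_norm ?exprn_ge0// => h; exists K.
    rewrite (le_trans (_ : _ <= q ^+ K * (1 + d / (1 - q))))//.
      by rewrite ler_wpM2l ?exprn_ge0// lerDr.
    by rewrite -ler_pdivlMr// ltW.
  exists K => m n Km Kn; rewrite -(subrKA (u K)) (le_trans (nrmD _ _))//.
  have := dn K (m - K)%N; have := dn K (n - K)%N; rewrite !subnKC//.
  by rewrite nrm_distC => *; lra.
exists l; apply/eqP; rewrite -subr_eq0; apply/eqP.
apply: (@nrm_small _ _ _ 2) => e e0; have [K hK] := hl e e0.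
have := hK K.+1 (leqnSn K); have := hK K (leqnn K) => h1 h2.
rewrite -(subrKA (u K.+1)) (le_trans (nrmD _ _))//.
have h3 : nrm (f l - u K.+1) <= q * nrm (u K - l).
  by rewrite [in leRHS]nrm_distC; exact: hf.
have : q * nrm (u K - l) <= nrm (u K - l) by rewrite ler_piMl ?nrm_ge0// ltW.
by move=> h4; lra.
Qed.

End Completeness.

Section Resolvent.
Variables (R : realType) (X : normedModType R[i]).
Implicit Types (x y : X) (T : {linear X -> X}) (z : R[i]).

(** The lower estimate makes [z - T] injective, so that a choice of preimages is
    automatically linear, and it bounds this inverse. *)
Lemma resolvent_of_surjective T z (c : R) : 0 < c ->
  (forall y, exists x, z *: x - T x = y) ->
  (forall x, c * nrm x <= nrm (z *: x - T x)) ->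
  exists2 S, is_resolvent T z S & opnorm S <= c^-1.
Proof.
move=> c0 surj hc; have [s hs] := choice surj.
have inj x y : z *: x - T x = z *: y - T y -> x = y.
  move=> e; apply/eqP; rewrite -subr_eq0; apply/eqP; apply: nrm_le0.
  have : c * nrm (x - y) <= 0.
    by rewrite (le_trans (hc _))// scalerBr linearB opprD addrACA -opprD e subrr nrm0.
  by rewrite pmulr_rle0.
have sl : linear s.
  move=> a x y; apply: inj; rewrite hs [T (_ + _)]linearP scalerDr opprD addrACA.
  by rewrite hs scalerA mulrC -scalerA -scalerBr hs.
pose S : {linear X -> X} := HB.pack s (GRing.isLinear.Build R[i] X X _ s sl).
have hS : bounded_by S c^-1.
  by move=> x; rewrite -ler_pdivrMl ?invr_gt0// invrK -[in leRHS](hs x) hc.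
exists S; last by apply: opnorm_le => //; rewrite invr_ge0 ltW.
split; first by apply/continuous_boundedP; exists c^-1 => //; rewrite invr_ge0 ltW.
  by move=> x; exact: hs.
by move=> x; apply: inj; rewrite hs.
Qed.

Lemma resolvent_lower_bound T z S (c : R) : is_resolvent T z S ->
  (forall x, c * nrm x <= nrm (z *: x - T x)) -> 0 < c -> opnorm S <= c^-1.
Proof.
move=> [_ h1 h2] hc c0; apply: opnorm_le; first by rewrite invr_ge0 ltW.
by move=> y; rewrite -ler_pdivrMl ?invr_gt0// invrK -[in leRHS](h1 y) hc.
Qed.

End Resolvent.

(** * The Neumann series, accretivity and interpolation *)
Section Neumann.
Variables (R : realType) (X : completeNormedModType R[i]).
Implicit Types (x y : X) (T : {linear X -> X}) (z w : R[i]).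

Lemma unit_distance_lower (V : X -> X) w x : nrm (x - V x) <= nrm x ->
  (cabs (w - 1) - 1) * nrm x <= nrm (w *: x - V x).
Proof.
move=> hV; have -> : w *: x - V x = (w - 1) *: x - - (x - V x).
  by rewrite opprK scalerBl scale1r addrA subrK.
rewrite (le_trans _ (nrm_lerB _ _))// nrmN nrmZ mulrBl mul1r.
by rewrite lerD2l lerN2.
Qed.

Lemma unit_distance_surjective (V : X -> X) w : linear V ->
  (forall x, nrm (x - V x) <= nrm x) -> 1 < cabs (w - 1) ->
  forall y, exists x, w *: x - V x = y.
Proof.
move=> lV hV w1 y; have c0 : 0 < cabs (w - 1) by rewrite (lt_trans _ w1).
have w0 : w - 1 != 0 by rewrite -cabs_gt0.
have VB a b : V (a - b) = V a - V b.
  by rewrite addrC -scaleN1r lV scaleN1r addrC.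
pose f x := (w - 1)^-1 *: (y - (x - V x)).
have [|a b|x fx] := @contraction_fixpoint _ _ f (cabs (w - 1))^-1.
- by rewrite invr_ge0 ltW//= invf_lt1.
- rewrite /f -scalerBr nrmZ cabsV ler_wpM2l ?invr_ge0 ?(ltW c0)//.
  set A := a - V a; set B := b - V b.
  rewrite [- (y - B)]opprD addrACA subrr add0r -opprD nrmN /A /B opprD addrACA -opprD -VB.
  exact: hV.
- exists x; have /(congr1 (fun v => (w - 1) *: v)) := fx.
  rewrite scalerA divff// scale1r scalerBl scale1r => /eqP.
  by rewrite subr_eq subrKA => /eqP ->.
Qed.

Lemma geom0 T z n : geom T z n 0 = 0.
Proof.
rewrite /geom big1// => i _; suff -> : iter i T 0 = 0 by rewrite scaler0.
by elim: (val i) => //= k ->; rewrite linear0.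
Qed.

Lemma geom_bounded T M z n x : 0 <= M -> bounded_by T M ->
  nrm (geom T z n x) <= (\sum_(i < n) cabs z ^+ (n.-1 - i) * M ^+ i) * nrm x.
Proof.
move=> M0 hM; rewrite (le_trans (nrm_sum _ _ _))// mulr_suml ler_sum// => i _.
by rewrite nrmZ cabsX -mulrA ler_wpM2l ?exprn_ge0 ?cabs_ge0// bounded_iter.
Qed.

(** Spectral mapping for the power [T^n]: as [I - T^n] is a contraction,
    [z^n - T^n] is invertible by the Neumann series as soon as
    [|z^n - 1| > 1], and [z - T] divides it. *)
Lemma resolvent_exists T n z : continuous T ->
  (forall x, nrm (x - iter n T x) <= nrm x) -> 1 < cabs (z ^+ n - 1) ->
  exists S, is_resolvent T z S.
Proof.
move=> /continuous_boundedP[M M0 hM] hT z1.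
pose g := cabs (z ^+ n - 1) - 1; have g0 : 0 < g by rewrite subr_gt0.
pose C := \sum_(i < n) cabs z ^+ (n.-1 - i) * M ^+ i.
have C0 : 0 <= C by apply: sumr_ge0 => i _; rewrite mulr_ge0 ?exprn_ge0 ?cabs_ge0.
have C1 : 0 < C + 1 by rewrite ltr_wpDl.
have [|y|x|S hS _] := @resolvent_of_surjective _ _ T z (g / (C + 1)).
- by rewrite divr_gt0.
- have [u <-] := unit_distance_surjective (iter_linear T n) hT z1 y.
  by exists (geom T z n u); rewrite -sub_powerl.
- rewrite mulrAC ler_pdivrMr// (le_trans (unit_distance_lower _ (hT x)))//.
  rewrite sub_powerr (le_trans (geom_bounded _ _ _ M0 hM))// mulrC.
  by rewrite ler_wpM2l ?nrm_ge0// lerDl.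
by exists S.
Qed.

End Neumann.

Section Accretive.
Variables (R : realType) (X : completeNormedModType R[i]) (T : {linear X -> X}).
Hypothesis accT : forall x, nrm (x - T x) <= nrm x.
Implicit Types (x y : X) (t : R).

Lemma accretive t x : 0 <= t -> t * nrm x <= nrm (t%:C *: x + T x).
Proof.
move=> t0; have -> : t%:C *: x + T x = (t + 1)%:C *: x - (x - T x).
  by rewrite rcD scalerDl scale1r opprB [T x - x]addrC addrA addrK.
rewrite (le_trans _ (nrm_lerB _ _))// nrmZ cabs_real ger0_norm ?addr_ge0//.
by rewrite mulrDl mul1r -addrA lerDl subr_ge0.
Qed.

(** Apply accretivity to [T x - t x], whose image under [t + T] is
    [T^2 x - t^2 x]. *)
Lemma landau t x : 0 <= t ->
  t * nrm (T x) <= nrm (T (T x)) + 2 * t ^+ 2 * nrm x.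
Proof.
move=> t0; have := @accretive t (T x - t%:C *: x) t0.
have -> : t%:C *: (T x - t%:C *: x) + T (T x - t%:C *: x) =
          T (T x) - (t ^+ 2)%:C *: x.
  rewrite scalerBr scalerA [T (_ - _)]linearB [T (_ *: _)]linearZ /= addrC subrKA.
  by rewrite -rcM expr2.
move=> h; have := nrmB (T (T x)) ((t ^+ 2)%:C *: x).
have := ler_wpM2l t0 (nrm_lerB (T x) (t%:C *: x)).
rewrite !nrmZ !cabs_real (ger0_norm t0) ger0_norm ?exprn_ge0//.
rewrite mulrBr mulrA -expr2 => h1 h2; lra.
Qed.

(** Let [t] tend to [0] in Landau's inequality, divided by [t]. *)
Lemma kernel_square x : T (T x) = 0 -> T x = 0.
Proof.
move=> h; apply: (@nrm_small _ _ _ (2 * nrm x)) => e e0.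
have := landau x (ltW e0); rewrite h nrm0 add0r expr2 mulrA -!mulrA.
by rewrite mulrCA ler_pM2l// => /le_trans; apply; rewrite [nrm x * e]mulrC.
Qed.

Lemma kernel_iter n x : (0 < n)%N -> iter n T x = 0 -> T x = 0.
Proof.
elim: n x => [//|[|n] IH x _ h]; first by [].
by apply: IH => //; apply: kernel_square.
Qed.

End Accretive.

(** Applied to [a k = |T^k u| / r^k], for which the hypothesis is
    [landau] and the constants do not depend on [r]. The
    intermediate step bounds [a k] by [a 0] and a small multiple of
    [a k.+1]. *)
Lemma landau_chain (R : realType) (n : nat) :
  exists2 C : R, 0 <= C & forall a : nat -> R, (forall k, 0 <= a k) ->
    (forall k s, 0 < s -> s * a k.+1 <= a k.+2 + 2 * s ^+ 2 * a k) ->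
    forall k, (k <= n)%N -> a k <= C * (a 0%N + a n).
Proof.
have step k (e : R) : 0 < e -> exists2 C : R, 0 <= C &
    forall a : nat -> R, (forall k, 0 <= a k) ->
    (forall k s, 0 < s -> s * a k.+1 <= a k.+2 + 2 * s ^+ 2 * a k) ->
    a k <= e * a k.+1 + C * a 0%N.
  elim: k e => [|k IH] e e0.
    by exists 1 => // a a0 _; rewrite mul1r lerDr mulr_ge0// ltW.
  (* With [1 / (4 s)] at rank [k], half of [s * a k.+1] is absorbed; the
     coefficient [2 / s] which results at rank [k.+1] is [e]. *)
  pose s := 2 / e; have s0 : 0 < s by rewrite divr_gt0.
  have [|C C0 hC] := IH (1 / (4 * s)); first by rewrite divr_gt0// mulr_gt0.
  exists (4 * s * C); first by rewrite mulr_ge0// mulr_ge0// ltW.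
  move=> a a0 ha; have h1 := hC a a0 ha; have h2 := ha k s s0.
  have h3 : 2 * s ^+ 2 * a k <= s / 2 * a k.+1 + 2 * s ^+ 2 * (C * a 0%N).
    apply: (le_trans (ler_wpM2l _ h1)); first by rewrite mulr_ge0 ?sqr_ge0.
    rewrite mulrDr mulrA (_ : 2 * s ^+ 2 * (1 / (4 * s)) = s / 2)//.
    by field; rewrite gt_eqF.
  have -> : e = 2 / s by rewrite /s; field; rewrite gt_eqF.
  have h4 : s * a k.+1 <= 2 * a k.+2 + 4 * s ^+ 2 * (C * a 0%N) by lra.
  rewrite -(ler_pM2l s0) (le_trans h4)//.
  rewrite (_ : s * (2 / s * a k.+2 + 4 * s * C * a 0%N) =
    2 * a k.+2 + 4 * s ^+ 2 * (C * a 0%N))//.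
  by field; rewrite gt_eqF.
elim: n => [|n [C C0 IH]].
  by exists 1 => // a a0 _ [|k]//; rewrite mul1r lerDl.
have [D D0 hD] := step n 1 ltr01.
exists (1 + C * (1 + D)); first by rewrite addr_ge0// mulr_ge0// addr_ge0.
move=> a a0 ha k; have h0 := a0 0%N; have h1 := a0 n.+1.
have CD : 0 <= C * (1 + D) by rewrite mulr_ge0// addr_ge0.
rewrite leq_eqVlt => /orP[/eqP->|kn].
  rewrite mulrDl mul1r (le_trans (_ : _ <= a 0%N + a n.+1)) ?lerDr//.
  by rewrite lerDl mulr_ge0// addr_ge0.
apply: (le_trans (IH a a0 ha k kn)).
rewrite (le_trans (_ : _ <= C * (1 + D) * (a 0%N + a n.+1)))//.
  rewrite -mulrA ler_wpM2l//; have := hD a a0 ha; rewrite mul1r => h2.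
  have := mulr_ge0 D0 h1; lra.
by rewrite ler_wpM2r ?addr_ge0// lerDr.
Qed.

Section SectorialBound.
Variables (R : realType) (X : completeNormedModType R[i]).
Implicit Types (x y : X) (T : {linear X -> X}).

(** With [u = (z^n - T^n)^-1 (z x - T x)] one has [x = geom T z n u]. The norm of
    [u] is controlled by hypothesis and that of [T^n u] by the equation; the
    terms [T^k u] in between follow by interpolation, uniformly in [|z|]. *)
Lemma sectorial_bound T n (d : R) : (0 < n)%N -> 0 < d ->
  (forall x, nrm (x - T x) <= nrm x) ->
  (forall x, nrm (x - iter n T x) <= nrm x) ->
  exists2 c : R, 0 < c & forall z : R[i], z != 0 ->
    d * cabs z ^+ n <= cabs (z ^+ n - 1) - 1 ->
    forall x, c * cabs z * nrm x <= nrm (z *: x - T x).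
Proof.
move=> n0 d0 accT accTn; have [C C0 hC] := landau_chain R n.
pose K := n%:R * C * (2 / d + 1) + 1.
have K0 : 0 < K.
  by rewrite ltr_wpDl// !mulr_ge0// addr_ge0// divr_ge0// ltW.
exists K^-1; first by rewrite invr_gt0.
move=> z z0 hz x; pose r := cabs z; have r0 : 0 < r by rewrite cabs_gt0.
set y := z *: x - T x.
have hg : 0 < cabs (z ^+ n - 1) - 1 by rewrite (lt_le_trans _ hz)// mulr_gt0// exprn_gt0.
have low u : d * r ^+ n * nrm u <= nrm (z ^+ n *: u - iter n T u).
  apply: le_trans (unit_distance_lower _ (accTn u)).
  by rewrite ler_wpM2r ?nrm_ge0.
have [|u hu] := unit_distance_surjective (iter_linear T n) accTn _ y (w := z ^+ n).
  by rewrite -subr_gt0.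
have inj v : z ^+ n *: v - iter n T v = 0 -> v = 0.
  move=> hv; apply: nrm_le0; have := low v.
  by rewrite hv nrm0 pmulr_rle0// mulr_gt0// exprn_gt0.
have xE : x = geom T z n u.
  apply/eqP; rewrite -subr_eq0; apply/eqP; apply: inj.
  rewrite sub_powerr scalerBr [T (_ - _)]linearB /= opprD addrACA -opprD.
  by rewrite -sub_powerl hu subrr geom0.
pose a k := nrm (iter k T u) / r ^+ k.
have a0 k : 0 <= a k by rewrite divr_ge0 ?nrm_ge0// exprn_ge0// ltW.
have ha k s : 0 < s -> s * a k.+1 <= a k.+2 + 2 * s ^+ 2 * a k.
  move=> s0; have sr : 0 <= s * r by rewrite mulr_ge0// ltW.
  have := landau accT (iter k T u) sr; rewrite /a -!iterS => h.
  have rk : 0 < r ^+ k.+2 by rewrite exprn_gt0.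
  have rk1 : r ^+ k != 0 by rewrite gt_eqF// exprn_gt0.
  have r1 : r != 0 by rewrite gt_eqF.
  rewrite -(ler_pM2r rk) mulrDl.
  have e1 : s * (nrm (iter k.+1 T u) / r ^+ k.+1) * r ^+ k.+2 =
     s * r * nrm (iter k.+1 T u) by rewrite !(exprS r); field; rewrite ?rk1 ?r1.
  have e2 : nrm (iter k.+2 T u) / r ^+ k.+2 * r ^+ k.+2 =
     nrm (iter k.+2 T u) by rewrite divfK// gt_eqF.
  have e3 : 2 * s ^+ 2 * (nrm (iter k T u) / r ^+ k) * r ^+ k.+2 =
     2 * (s * r) ^+ 2 * nrm (iter k T u) by rewrite !(exprS r); field.
  by rewrite e1 e2 e3.
have rx : r * nrm x <= n%:R * (C * (a 0%N + a n)) * r ^+ n.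
  rewrite {1}xE (le_trans (ler_wpM2l (ltW r0) (nrm_sum _ _ _)))//.
  have -> : n%:R * (C * (a 0%N + a n)) * r ^+ n =
      \sum_(i < n) C * (a 0%N + a n) * r ^+ n.
    by rewrite sumr_const card_ord -[RHS]mulr_natl !mulrA.
  rewrite mulr_sumr ler_sum// => i _; rewrite nrmZ cabsX -/r.
  have -> : r * (r ^+ (n.-1 - i) * nrm (iter i T u)) = a i * r ^+ n.
    rewrite /a mulrA -exprS mulrC -mulrA; congr (_ * _).
    have ri : r ^+ i != 0 by rewrite gt_eqF// exprn_gt0.
    apply: (mulfI ri); rewrite mulVKf// -exprD; congr (_ ^+ _).
    by have := ltn_ord i; lia.
  by rewrite ler_wpM2r ?exprn_ge0 ?(ltW r0)// hC// ltnW.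
have rn0 : 0 < r ^+ n by rewrite exprn_gt0.
have u0 : r ^+ n * nrm u <= nrm y / d.
  by rewrite ler_pdivlMr// -hu (le_trans _ (low u))// mulrC mulrA.
have un : nrm (iter n T u) <= (1 / d + 1) * nrm y.
  have := nrmB (z ^+ n *: u) (z ^+ n *: u - iter n T u).
  rewrite opprB addrC subrK hu nrmZ cabsX -/r => h; lra.
have an : a n * r ^+ n = nrm (iter n T u) by rewrite /a divfK// gt_eqF.
have a0E : a 0%N * r ^+ n = r ^+ n * nrm u by rewrite /a expr0 invr1 mulr1 mulrC.
rewrite -mulrA ler_pdivrMl// (le_trans rx)//.
have -> : n%:R * (C * (a 0%N + a n)) * r ^+ n = n%:R * C * (r ^+ n * nrm u + nrm (iter n T u)).
  by rewrite -an -a0E; ring.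
rewrite (le_trans (_ : _ <= n%:R * C * ((2 / d + 1) * nrm y)))//.
  by rewrite ler_wpM2l ?mulr_ge0//; lra.
by rewrite mulrA ler_wpM2r ?nrm_ge0// /K lerDl.
Qed.

End SectorialBound.

(** * Directions, spectrum and sectoriality *)
Section Unboundedness.

Lemma infinite_unbounded (N : set nat) :
  infinite_set N <-> forall K, exists2 n, N n & (K <= n)%N.
Proof.
split=> [infN K|h].
  apply: contrapT => hn; apply: infN; apply: (@sub_finite_set _ _ `I_K); last exact: finite_II.
  by move=> n Nn /=; rewrite ltnNge; apply/negP => Kn; apply: hn; exists n.
move=> /finite_seqP[s sE]; have [n] := h (\max_(i <- s) i).+1.
by rewrite sE /= => ns; rewrite ltnNge leq_bigmax_seq.
Qed.

Lemma expr_unbounded (R : realType) (r C : R) : 1 < r -> exists2 m, (0 < m)%N & C <= r ^+ m.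
Proof.
move=> r1; have bern m : 1 + (r - 1) *+ m <= r ^+ m.
  elim: m => [|k IH]; first by rewrite mulr0n addr0.
  rewrite exprS mulrSr -[X in X * _](subrK 1) mulrDl mul1r.
  have k0 : 0 <= (r - 1) *+ k by rewrite mulrn_wge0// subr_ge0 ltW.
  have h2 : r - 1 <= (r - 1) * r ^+ k.
    by rewrite ler_peMr ?subr_ge0 ?(ltW r1)// (le_trans _ IH)// lerDl.
  by lra.
exists (Num.truncn (C / (r - 1))).+1 => //; apply: le_trans (bern _).
rewrite -mulr_natl; have : C / (r - 1) < (Num.truncn (C / (r - 1))).+1%:R.
  exact: truncnS_gt.
by rewrite ltr_pdivrMr ?subr_gt0// => h; lra.
Qed.

End Unboundedness.

Section Polar.
Variable R : realType.
Implicit Types (z : R[i]) (r s d t theta : R).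

Lemma cisD s t : cis (s + t) = cis s * cis t.
Proof. by rewrite /cis cosD sinD; simpc; rewrite [sin s * cos t + _]addrC. Qed.

Lemma cis0 : cis (0 : R) = 1.
Proof. by rewrite /cis cos0 sin0. Qed.

Lemma cisX n t : cis t ^+ n = cis (n%:R * t).
Proof.
elim: n => [|n IH]; first by rewrite mul0r cis0.
by rewrite exprS IH -cisD -natr1 mulrDl mul1r addrC.
Qed.

Lemma cabs_cis t : cabs (cis t) = 1.
Proof.
apply/eqP; rewrite -(@eqrXn2 _ 2) ?cabs_ge0// cabs_sqr /= cos2Dsin2.
by rewrite expr1n.
Qed.

Lemma polar z : z != 0 -> z = (cabs z)%:C * cis (arg z).
Proof. by move=> /argP[_ {1}->]; rewrite cabsE. Qed.

Lemma polar_power z n : z != 0 ->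
  z ^+ n = (cabs z ^+ n)%:C * cis (n%:R * arg z).
Proof. by move=> /polar {1}->; rewrite exprMn cisX rcX. Qed.

Lemma cabs_sub1_sqr r t :
  cabs (r%:C * cis t - 1) ^+ 2 = r ^+ 2 - 2 * r * cos t + 1.
Proof.
rewrite cabs_sqr /cis; simpc => /=; have := cos2Dsin2 t => h.
have -> : r ^+ 2 = r ^+ 2 * (cos t ^+ 2 + sin t ^+ 2) by rewrite h mulr1.
by ring.
Qed.

(** [|s e^(i t) - 1|^2 >= 1 + 2 d s + s^2 >= (1 + d s)^2]. *)
Lemma far_from_one s d t : 0 <= s -> 0 <= d <= 1 -> cos t <= - d ->
  d * s <= cabs (s%:C * cis t - 1) - 1.
Proof.
move=> s0 /andP[d0 d1] ct; rewrite lerBrDr -(@ler_pXn2r _ 2) ?nnegrE ?cabs_ge0//.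
  rewrite cabs_sub1_sqr.
  have h1 : s * cos t <= s * - d by rewrite ler_wpM2l.
  have h2 : (d * s) ^+ 2 <= s ^+ 2.
    by rewrite exprMn ler_piMl ?sqr_ge0// expr_le1.
  by rewrite sqrrD; lra.
by rewrite addr_ge0// mulr_ge0.
Qed.

Lemma near_one_cos s t : 0 < s -> cabs (s%:C * cis t - 1) <= 1 -> s / 2 <= cos t.
Proof.
move=> s0; rewrite -(@ler_pXn2r _ 2) ?nnegrE ?cabs_ge0// expr1n cabs_sub1_sqr => h.
by rewrite -(ler_pM2l s0); lra.
Qed.

Lemma arg_bound z : z != 0 -> - pi <= arg z <= pi.
Proof. by move=> /argP[/andP[/ltW-> ->]]. Qed.

Lemma arg_pos r : 0 < r -> arg r%:C = 0.
Proof.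
move=> r0; rewrite /arg -/(cabs r%:C) cabs_real gtr0_norm//= lexx.
by rewrite divff ?gt_eqF// acos1.
Qed.

Lemma sector_closure0 (omega : R) : 0 < omega ->
  closure (sector omega : set (R[i] : numFieldType)) 0.
Proof.
move=> w0 B; rewrite -nbhs_ballE => -[e /= e0 hB].
have eR : e = (complex.Re e)%:C.
  by move: e0; rewrite ltcE /=; case: (e) => a b /= /andP[/eqP-> _].
have r0 : 0 < complex.Re e by move: e0; rewrite {1}eR ltcR.
have r2 : 0 < complex.Re e / 2 by rewrite divr_gt0.
exists (complex.Re e / 2)%:C; split.
  split; first by rewrite -cabs_gt0 cabs_real gtr0_norm.
  by rewrite arg_pos// normr0.
apply: hB; rewrite -ball_normE /ball_ /= sub0r normrN cabsE cabs_real gtr0_norm//.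
by rewrite eR ltcR /= ltr_pdivrMr// ltr_pMr// ltr1n.
Qed.

End Polar.

Section PartOne.
Variables (R : realType) (X : completeNormedModType R[i]).
Implicit Types (x y : X) (T : {linear X -> X}) (N : set nat) (z : R[i]).

Lemma resolvent_bounded_of_lower T (A : set R[i]) (w : R[i] -> R[i]) (c : R) :
  0 < c ->
  (forall z, A z -> exists S, is_resolvent T z S) ->
  (forall z, A z -> forall x, c * cabs (w z) * nrm x <= nrm (z *: x - T x)) ->
  resolvent_bounded_on T A w.
Proof.
move=> c0 hS hc; exists c^-1 => z Az; have [S Sz] := hS z Az.
exists S => //; rewrite -/(cabs (w z)).
have := cabs_ge0 (w z); rewrite le_eqVlt => /orP[/eqP<-|wz].
  by rewrite mul0r invr_ge0 ltW.
have := resolvent_lower_bound Sz (hc z Az); rewrite mulr_gt0// => /(_ isT) h.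
by rewrite mulrC -ler_pdivlMr// -invfM.
Qed.

Lemma not_Theta N (t : R) : - pi <= t <= pi -> ~ Theta N t ->
  exists2 n, N n & cos (n%:R * t) < 0.
Proof.
move=> tpi nT; apply: contrapT => h; apply: nT; split => // n Nn.
by rewrite leNgt; apply/negP => c; apply: h; exists n.
Qed.

(** Each direction off [Theta N] has a power whose cosine is negative on a
    whole neighbourhood; finitely many such neighbourhoods suffice. *)
Lemma sector_lower_bound N T (omega : R) : index_set N ->
  (forall n, N n -> forall x, nrm (x - iter n T x) <= nrm x) ->
  betaN N < omega ->
  exists2 c : R, 0 < c & forall z, z != 0 -> omega <= `|arg z| ->
    forall x, c * cabs z * nrm x <= nrm (z *: x - T x).
Proof.
move=> [_ N1 Npos] hT bw.
pose K := [set t : R | omega <= `|t| /\ - pi <= t <= pi].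
pose P (M : R) (t : R) := forall r : R, 0 < r -> forall x,
  r * nrm x <= M * nrm ((r%:C * cis t) *: x - T x).
have cK : compact K.
  have -> : K = `[- pi, pi]%classic `&` (fun t : R => `|t|) @^-1` [set x | omega <= x].
    by apply/seteqP; split=> t /=; rewrite /K /= in_itv/= => -[].
  apply: (@subclosed_compact _ _ `[- pi, pi]%classic).
  - apply: closedI; first exact: itv_closed.
    apply: preimage_closed; last exact: closed_ge.
    by move=> t _; exact: norm_continuous.
  - exact: segment_compact.
  - by move=> t [].
(* The bound [M] is the filtered parameter: it may be enlarged near each
   direction, and compactness yields one [M] for all of them. *)
have /compact_near_coveringP/(_ R (pinfty_nbhs R) P) := cK.
move=> /(_ _ _)[].
  move=> t [wt tpi].
  have [|n Nn cn] := @not_Theta N t tpi.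
    by move=> /(betaN_max N).2; rewrite leNgt (lt_le_trans bw).
  pose d := Num.min 1 (- cos (n%:R * t) / 2).
  have d0 : 0 < d by rewrite lt_min ltr01 divr_gt0// oppr_gt0.
  have d1 : d <= 1 by rewrite ge_min lexx.
  have dc : cos (n%:R * t) < - d.
    have : d <= - cos (n%:R * t) / 2 by rewrite ge_min lexx orbT.
    by lra.
  have [c c0 hc] := sectorial_bound (Npos n Nn) d0 (hT 1%N N1) (hT n Nn).
  have near1 : \forall t' \near t, cos (n%:R * t') <= - d.
    have ct : {for t, continuous (fun t' : R => cos (n%:R * t'))}.
      apply: continuous_comp; last exact: continuous_cos.
      exact: mulrl_continuous.
    have h : \forall t' \near t, cos (n%:R * t') < - d := ct _ (lt_nbhsl dc).
    by near=> t'; apply: ltW; near: t'.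
  have near2 : \forall M \near +oo, c^-1 <= M by apply: nbhs_pinfty_ge; exact: num_real.
  near=> t' M => r r0 x.
  have ct' : cos (n%:R * t') <= - d by near: t'.
  have cM : c^-1 <= M by near: M.
  have rz : cabs (r%:C * cis t') = r by rewrite cabsM cabs_cis cabs_real mulr1 gtr0_norm.
  have z0 : r%:C * cis t' != 0 by rewrite -cabs_gt0 rz.
  rewrite (le_trans (_ : _ <= c^-1 * nrm ((r%:C * cis t') *: x - T x)))//.
    rewrite -ler_pdivrMl ?invr_gt0// invrK mulrA -{1}rz; apply: hc => //.
    rewrite rz exprMn cisX -rcX; apply: far_from_one => //.
      by rewrite exprn_ge0// ltW.
    by rewrite d1 ltW.
  by rewrite ler_wpM2r ?nrm_ge0.
move=> M [_ hM].
have [M' /= M'1] : exists2 M', 0 < M' & K `<=` P M'.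
  exists (Num.max M 0 + 1); first by rewrite ltr_wpDl// le_max lexx orbT.
  by apply: hM; rewrite ltr_pwDr// le_max lexx.
move=> hP; exists M'^-1; first by rewrite invr_gt0.
move=> z z0 wz x; rewrite -mulrA ler_pdivrMl//.
have zK : K (arg z) by split => //; exact: arg_bound.
by have := hP _ zK (cabs z); rewrite -polar// cabs_gt0; exact.
Unshelve. all: by end_near.
Qed.

Lemma spectrum_direction N T z : continuous T ->
  (forall n, N n -> forall x, nrm (x - iter n T x) <= nrm x) ->
  spectrum T z -> z != 0 -> forall n, N n -> cabs z ^+ n / 2 <= cos (n%:R * arg z).
Proof.
move=> cT hT sz z0 n Nn; apply: near_one_cos.
  by rewrite exprn_gt0// cabs_gt0.
rewrite -polar_power// leNgt; apply/negP => h.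
by apply: sz; apply: (resolvent_exists cT (hT n Nn)).
Qed.

(** The powers [|z|^n] are bounded by [2] along the infinite set [N]. *)
Lemma spectrum_Theta N T z : continuous T -> infinite_set N ->
  (forall n, N n -> forall x, nrm (x - iter n T x) <= nrm x) ->
  spectrum T z -> z != 0 -> Theta N (arg z) /\ cabs z <= 1.
Proof.
move=> cT infN hT sz z0; have h := spectrum_direction cT hT sz z0.
have r0 : 0 < cabs z by rewrite cabs_gt0.
split.
  split; first exact: arg_bound.
  by move=> n Nn; apply: le_trans (h n Nn); rewrite divr_ge0// exprn_ge0// ltW.
rewrite leNgt; apply/negP => r1.
have [m _ hm] := expr_unbounded 3 r1.
have [n Nn mn] := (infinite_unbounded N).1 infN m.
have := le_trans (h n Nn) (cos_le1 _); rewrite ler_pdivrMr// mul1r.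
apply/negP; rewrite -ltNge (lt_le_trans _ (le_trans hm (ler_weXn2l (ltW r1) mn)))//.
by rewrite ltr_nat.
Qed.

End PartOne.

(** * A Liouville theorem *)
Section Liouville.
Variables (R : realType) (X : completeNormedModType R[i]).
Variable Y : set X.
Hypothesis Ylin : forall (a : R[i]) x y, Y x -> Y y -> Y (a *: x + y).
Implicit Types (x y : X) (S T : {linear X -> X}) (mu z : R[i]).

(** A bound on [k(mu S)] over [Y] for all [mu], where [k(u) = u / (1 - u)^2] is
    the Koebe function; it is stated without inverting [1 - mu S]. *)
Definition koebe_bound S (M : R) := forall mu y, Y y ->
  nrm (mu *: S y) <= M * nrm (pol S ((1 - mu%:P * 'X) ^+ 2) y).

Let invariant S := forall y, Y y -> Y (S y).

Lemma invariant_pol S p y : invariant S -> Y y -> Y (pol S p y).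
Proof.
move=> YS Yy; have Yi i : Y (iter i S y) by elim: i => //= i; exact: YS.
have Y0 : Y 0 by have := Ylin (-1) Yy Yy; rewrite scaleN1r addNr.
rewrite /pol; elim/big_ind: _ => // [u v Yu Yv|i _].
  by rewrite -[u]scale1r; exact: Ylin.
by rewrite -[_ *: _]addr0; apply: Ylin.
Qed.

Lemma pol_factor S mu y : pol S (1 - mu%:P * 'X) y = y - mu *: S y.
Proof. by rewrite polB -polyC1 polC scale1r mul_polyC polZ -['X]expr1 polXn. Qed.

(** The function [k(u) = u / (1 - u)^2] satisfies
    [k(u) + k(-u) = 4 k(u^2)], so squaring the operator halves the bound. *)
Lemma koebe_bound_square S M : invariant S -> koebe_bound S M ->
  koebe_bound (S \o S) (M / 2).
Proof.
move=> YS hM mu y Yy; pose s := sqrtc mu; have sE : s ^+ 2 = mu by exact: sqr_sqrtc.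
pose q := pol S ((1 - mu%:P * 'X^2) ^+ 2) y.
have -> : pol (S \o S) ((1 - mu%:P * 'X) ^+ 2) y = q.
  have fE v : pol (S \o S) (1 - mu%:P * 'X) v = pol S (1 - mu%:P * 'X^2) v.
    rewrite pol_factor polB -polyC1 polC scale1r mul_polyC polZ polXn //.
  by rewrite /q !expr2 !polM !fE.
have half t : t ^+ 2 = mu ->
    nrm (pol S (t%:P * 'X * (1 + t%:P * 'X) ^+ 2) y) <= M * nrm q.
  move=> tE; rewrite polM.
  have := hM t _ (invariant_pol ((1 + t%:P * 'X) ^+ 2) YS Yy).
  rewrite -polM -exprMn -subr_sqr expr1n exprMn -rmorphXn tE -/q.
  by rewrite mul_polyC polZ -['X]expr1 polXn.
have h1 := half s sE; have h2 := half (- s); rewrite sqrrN in h2.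
have {h2} := h2 sE; set b := pol _ _ y => h2; set a := pol _ _ y in h1.
have e : 4%:R *: (mu *: (S \o S) y) = a + b.
  rewrite -[(S \o S) y]/(iter 2 S y) -polXn -!polZ -polD; congr (pol _ _ _).
  rewrite -!mul_polyC -sE rmorphXn rmorph_nat rmorphN /=; ring.
have : nrm (4%:R *: (mu *: (S \o S) y)) <= M * nrm q + M * nrm q.
  by rewrite e (le_trans (nrmD _ _))// lerD.
rewrite nrmZ -[4%:R : R[i]](rmorph_nat (real_complex R)) cabs_real ger0_norm//.
by move=> h; lra.
Qed.

(** Take [mu = 1 / K] and expand the square: [|S y| / K] is then at most
    [(|y| + 3 |S y| / K) / 5]. *)
Lemma koebe_bound_halving S (K : R) : invariant S -> 0 < K ->
  koebe_bound S (1 / 5) -> (forall y, Y y -> nrm (S y) <= K * nrm y) ->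
  forall y, Y y -> nrm (S y) <= K / 2 * nrm y.
Proof.
move=> YS K0 hS hK y Yy; have := hS (K^-1)%:C y Yy.
have -> : pol S ((1 - ((K^-1)%:C)%:P * 'X) ^+ 2) y =
  (y - (K^-1)%:C *: S y) - ((K^-1)%:C *: S y - (K^-1)%:C *: ((K^-1)%:C *: S (S y))).
  rewrite expr2 polM !pol_factor; congr (_ - _).
  by rewrite [S (_ - _)]linearB [S (_ *: _)]linearZ /= scalerBr.
set u := (K^-1)%:C *: S y; set v := _ *: (_ *: _).
have vu : nrm v <= nrm u.
  rewrite /v /u !nrmZ cabs_real ger0_norm ?invr_ge0 ?(ltW K0)//.
  rewrite ler_wpM2l ?invr_ge0 ?(ltW K0)// ler_pdivrMl//; exact/hK/YS.
have := nrmB (y - u) (u - v); have := nrmB y u; have := nrmB u v => h1 h2 h3 h4.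
have h5 : nrm u <= nrm y / 2 by lra.
move: h5; rewrite /u nrmZ cabs_real ger0_norm ?invr_ge0 ?(ltW K0)//.
by rewrite ler_pdivrMl// => h5; rewrite -mulrA [2^-1 * _]mulrC.
Qed.

Lemma koebe_bound_small S (K : R) : invariant S -> 0 < K -> bounded_by S K ->
  koebe_bound S (1 / 5) -> forall y, Y y -> S y = 0.
Proof.
move=> YS K0 bK hS.
have hK k y : Y y -> nrm (S y) <= K / 2 ^+ k * nrm y.
  elim: k y => [|k IH] y; first by rewrite expr0 divr1 => _; exact: bK.
  have := @koebe_bound_halving S (K / 2 ^+ k) YS.
  rewrite divr_gt0 ?exprn_gt0// => /(_ isT hS IH y).
  by rewrite exprSr invfM mulrA.
move=> y Yy; apply: (@nrm_small _ _ _ (K * nrm y)) => e e0.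
have [k hk] : exists k : nat, e^-1 < k%:R.
  by exists (Num.truncn (e^-1)).+1; rewrite truncnS_gt.
apply: (le_trans (hK k y Yy)); rewrite mulrAC ler_wpM2l ?mulr_ge0 ?nrm_ge0 ?(ltW K0)//.
rewrite -[e]invrK lef_pV2 ?posrE ?exprn_gt0 ?invr_gt0// (le_trans (ltW hk))//.
by rewrite -natrX ler_nat ltnW// ltn_expl.
Qed.

(** A resolvent bounded by [1 / (c |z|)] at every [z != 0] gives a bound on
    [k(mu T)] for all [mu], which squaring drives to zero: this replaces
    Liouville's theorem. What remains, [T^(2^k) = 0], is improved to [T = 0]
    by accretivity. *)
Lemma liouville T (c : R) : continuous T -> invariant T ->
  (forall x, nrm (x - T x) <= nrm x) -> 0 < c ->
  (forall z, z != 0 -> forall y, Y y -> c * cabs z * nrm y <= nrm (z *: y - T y)) ->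
  forall y, Y y -> T y = 0.
Proof.
move=> /continuous_boundedP[B B0 hB] YT accT c0 hc.
have low mu v : mu != 0 -> Y v -> c * nrm v <= nrm (v - mu *: T v).
  move=> mu0 Yv.
  have := hc mu^-1; rewrite invr_eq0 => /(_ mu0 v Yv).
  rewrite cabsV => h; have m0 : 0 < cabs mu by rewrite cabs_gt0.
  have -> : v - mu *: T v = mu *: (mu^-1 *: v - T v).
    by rewrite scalerBr scalerA divff// scale1r.
  by rewrite nrmZ -ler_pdivrMl// mulrA [_^-1 * c]mulrC.
pose M := (1 / c + 1) / c; have M0 : 0 <= M by rewrite divr_ge0 ?(ltW c0)// addr_ge0// divr_ge0// ltW.
have hM : koebe_bound T M.
  move=> mu y Yy; have [->|mu0] := eqVneq mu 0.
    by rewrite scale0r nrm0 mulr_ge0 ?nrm_ge0.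
  rewrite expr2 polM !pol_factor; set u := y - mu *: T y.
  have Yu : Y u by rewrite /u -pol_factor; exact: invariant_pol.
  have h1 := low mu y mu0 Yy; have h2 := low mu u mu0 Yu.
  have h3 : nrm (mu *: T y) <= (1 / c + 1) * nrm u.
    have := nrmB y u; rewrite {1}/u opprB addrC subrK => h3.
    by rewrite (le_trans h3)// mulrDl !mul1r lerD2r ler_pdivlMl.
  rewrite (le_trans h3)// /M -mulrA ler_wpM2l//.
    by rewrite addr_ge0// divr_ge0// ltW.
  by rewrite ler_pdivlMl.
have iterS k : exists S : {linear X -> X}, [/\ S =1 iter (2 ^ k) T, invariant S,
    (exists2 K, 0 < K & bounded_by S K) & koebe_bound S (M / 2 ^+ k)].
  elim: k => [|k [S [ST YS [K K0 bK] hS]]].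
    exists T; split=> //; last by rewrite expr0 divr1.
    exists (B + 1) => [|x]; first by rewrite ltr_wpDl.
    by rewrite (le_trans (hB x))// ler_wpM2r ?nrm_ge0// lerDl.
  exists (S \o S : {linear X -> X}); split.
  - by move=> x; rewrite /= ST expnS mul2n -addnn iterD -!ST.
  - by move=> y Yy; apply/YS/YS.
  - exists (K * K); first by rewrite mulr_gt0.
    by move=> x; rewrite (le_trans (bK _))// -mulrA ler_wpM2l ?(ltW K0).
  - by rewrite exprSr invfM mulrA; exact: koebe_bound_square.
move=> y Yy; have [k hk] : exists k : nat, 5 * M < k%:R.
  by exists (Num.truncn (5 * M)).+1; rewrite truncnS_gt.
have [S [ST YS [K K0 bK] hS]] := iterS k.
apply: (@kernel_iter _ _ _ accT (2 ^ k)); first by rewrite expn_gt0.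
rewrite -ST; apply: (koebe_bound_small YS K0 bK) => // mu v Yv.
rewrite (le_trans (hS mu v Yv))// ler_wpM2r ?nrm_ge0// ler_pdivrMr ?exprn_gt0//.
have : (k%:R : R) <= 2 ^+ k by rewrite -natrX ler_nat ltnW// ltn_expl.
by lra.
Qed.

End Liouville.

(** * The binomial series *)
Section BinomialSeries.
Variable R : realType.
Implicit Types (al be e : R) (k n K : nat).

(** The coefficients of [(1 - u)^al]. *)
Fixpoint bincoef al k : R :=
  if k is k'.+1 then bincoef al k' * (k'%:R - al) / k%:R else 1.

Lemma bincoef_le0 al k : 0 <= al <= 1 -> (0 < k)%N -> bincoef al k <= 0.
Proof.
move=> /andP[a0 a1]; elim: k => // -[|k] IH _.
  by rewrite /= sub0r mul1r divr1 oppr_le0.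
rewrite [bincoef _ _]/(_ * _ / _) ler_pdivrMr ?ltr0n// mul0r.
by rewrite mulr_le0_ge0 ?IH// subr_ge0 (le_trans a1)// ler1n.
Qed.

(** For [0 < al <= 1] the coefficients other than the first are nonpositive and
    the full series adds up to [0] at [u = 1], so this partial sum is also the
    l1-norm of the remainder of the series. *)
Definition bintail al K : R := \sum_(k < K.+1) bincoef al k.

Lemma bintail0 al : bintail al 0 = 1.
Proof. by rewrite /bintail big_ord1. Qed.

Lemma bincoefS_tail al K : bincoef al K.+1 * K.+1%:R = - al * bintail al K.
Proof.
elim: K => [|K IH]; first by rewrite bintail0 /= sub0r mul1r divr1 mulr1.
rewrite {1}/bincoef -/(bincoef al K.+1) divfK ?pnatr_eq0//.
by rewrite /bintail big_ord_recr -/(bintail al K) [RHS]mulrDr -IH; ring.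
Qed.

Lemma bintailS al K : bintail al K.+1 = bintail al K * (1 - al / K.+1%:R).
Proof.
have K0 : K.+1%:R != 0 :> R by rewrite pnatr_eq0.
rewrite {1}/bintail big_ord_recr -/(bintail al K) /= -[bincoef al K * _ / _]/(bincoef al K.+1).
by apply: (mulIf K0); rewrite mulrDl bincoefS_tail; field.
Qed.

Lemma bintail_ratio al K : 0 <= al <= 1 -> 0 <= 1 - al / K.+1%:R <= 1.
Proof.
move=> /andP[a0 a1]; rewrite subr_ge0 ler_pdivrMr ?ltr0n// mul1r gerBl divr_ge0//.
by rewrite (le_trans a1)// ler1n.
Qed.

Lemma bintail_itv al K : 0 <= al <= 1 -> 0 <= bintail al K <= 1.
Proof.
move=> h; elim: K => [|K /andP[IH1 IH2]]; first by rewrite bintail0 ler01 lexx.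
have /andP[r0 r1] := bintail_ratio K h.
by rewrite bintailS mulr_ge0//= mulr_ile1.
Qed.

Lemma bintail_decr al K L : 0 <= al <= 1 -> (K <= L)%N -> bintail al L <= bintail al K.
Proof.
move=> h /subnK <-; elim: (L - K)%N => [|k IH]; first by rewrite add0n.
have /andP[r0 r1] := bintail_ratio (k + K) h.
have /andP[t0 _] := bintail_itv (k + K) h.
by rewrite addSn bintailS (le_trans _ IH)// ler_piMr.
Qed.

(** The tail tends to zero: with [1 <= n al], the [n]-th power of each
    factor [1 - al / k] is at most [1 / (1 + n al / k) <= k / (k + 1)], and the
    product telescopes. *)
Lemma bintail_power al n K : 0 <= al <= 1 -> 1 <= n%:R * al ->
  bintail al K ^+ n * K.+1%:R <= 1.
Proof.
move=> h na; elim: K => [|K IH]; first by rewrite bintail0 expr1n mul1r.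
have /andP[r0 r1] := bintail_ratio K h.
have /andP[t0 _] := bintail_itv K h.
set x := al / K.+1%:R in r0 r1.
have K0 : 0 < K.+1%:R :> R by rewrite ltr0n.
have x0 : 0 <= x by rewrite divr_ge0//; case/andP: h.
have bern m : (1 - x) ^+ m * (1 + m%:R * x) <= 1.
  elim: m => [|m IHm]; first by rewrite expr0 mul0r addr0 mulr1.
  apply: le_trans IHm; rewrite exprSr -mulrA ler_wpM2l ?exprn_ge0//.
  rewrite -natr1; have : 0 <= x * (m%:R * x + x) by rewrite mulr_ge0// addr_ge0// mulr_ge0.
  by lra.
rewrite bintailS exprMn -/x.
apply: le_trans IH; rewrite -mulrA ler_wpM2l ?exprn_ge0//.
have K2 : K.+2%:R = K.+1%:R * (1 + K.+1%:R^-1) :> R.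
  by rewrite mulrDr mulr1 divff ?gt_eqF// natr1.
rewrite K2 mulrCA -[leRHS]mulr1 ler_wpM2l ?(ltW K0)//.
apply: le_trans (bern n); rewrite ler_wpM2l ?exprn_ge0// lerD2l.
by rewrite /x mulrA -[leLHS]mul1r ler_wpM2r// invr_ge0 ltW.
Qed.

Lemma bintail_small al e : 0 < al <= 1 -> 0 < e -> exists K, bintail al K <= e.
Proof.
move=> /andP[a0 a1] e0; have al01 : 0 <= al <= 1 by rewrite ltW.
pose n := (Num.truncn (al^-1)).+1.
have na : 1 <= n%:R * al by rewrite -ler_pdivrMr// mul1r ltW// truncnS_gt.
pose K := Num.truncn ((e ^+ n)^-1).
exists K; have /andP[t0 _] := bintail_itv K al01.
rewrite -(@ler_pXn2r _ n) ?nnegrE ?(ltW e0)//.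
have := bintail_power K al01 na; rewrite -ler_pdivlMr ?ltr0n// mul1r => h.
rewrite (le_trans h)// -[leRHS]invrK lef_pV2 ?posrE ?ltr0n ?invr_gt0 ?exprn_gt0//.
by rewrite ltW// truncnS_gt.
Qed.

(** Chu-Vandermonde, by induction on [k]: split the factor [k.+1] into
    [i + (k.+1 - i)] and use the recurrence of the coefficients on each part. *)
Lemma bincoef_convolution al be k :
  \sum_(i < k.+1) bincoef al i * bincoef be (k - i) = bincoef (al + be) k.
Proof.
have rec c j : j.+1%:R * bincoef c j.+1 = (j%:R - c) * bincoef c j.
  by rewrite /= mulrC divfK ?pnatr_eq0// mulrC.
elim: k => [|k IH]; first by rewrite big_ord1 subn0 /= mulr1.
have k0 : k.+1%:R != 0 :> R by rewrite pnatr_eq0.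
apply: (mulfI k0); rewrite rec -IH !mulr_sumr.
transitivity (\sum_(i < k.+2) (i%:R * bincoef al i * bincoef be (k.+1 - i) +
    (k.+1 - i)%:R * bincoef be (k.+1 - i) * bincoef al i)).
  apply: eq_bigr => i _; have ik : (i <= k.+1)%N by rewrite -ltnS.
  by rewrite -{1}(subnK ik) natrD; ring.
rewrite big_split /= big_ord_recl !mul0r add0r [X in _ + X]big_ord_recr /=.
rewrite subnn !mul0r addr0 -big_split; apply: eq_bigr => i _ /=.
have ik : (i <= k)%N by rewrite -ltnS.
rewrite /bump leq0n add1n subSS subSn// !rec natrB//; ring.
Qed.

Definition bintrunc al K : {poly R} := \poly_(k < K.+1) bincoef al k.

Lemma bintrunc_at1 al K : (bintrunc al K).[1] = bintail al K.
Proof. by rewrite horner_poly; apply: eq_bigr => k _; rewrite expr1n mulr1. Qed.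

Definition nneg_coefs (p : {poly R}) := forall i, 0 <= p`_i.

Lemma nneg_one_sub_bintrunc al K : 0 <= al <= 1 -> nneg_coefs (1 - bintrunc al K).
Proof.
move=> h [|k]; rewrite coefB coef1 coef_poly; first by rewrite /= subrr.
by rewrite [(_ == _)%:R]/= sub0r oppr_ge0; case: ifP => // _; rewrite bincoef_le0.
Qed.

Lemma nneg_bintrunc_sub al K L : 0 <= al <= 1 -> (K <= L)%N ->
  nneg_coefs (bintrunc al K - bintrunc al L).
Proof.
move=> h KL i; rewrite coefB !coef_poly; case: ifP => iK.
  by rewrite (leq_trans iK)// subrr.
rewrite sub0r oppr_ge0; case: ifP => // _; rewrite bincoef_le0//.
by move/negbT: iK; rewrite -leqNgt; apply: leq_trans.
Qed.

(** Below degree [K] the product of the two truncations agrees with the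
    truncation for [al + be]; above, only products of two nonpositive
    coefficients occur. *)
Lemma nneg_bintrunc_mul al be K : 0 <= al -> 0 <= be -> al + be <= 1 ->
  nneg_coefs (bintrunc al K * bintrunc be K - bintrunc (al + be) K).
Proof.
move=> a0 b0 ab m; have ha : 0 <= al <= 1 by rewrite a0 (le_trans _ ab)// lerDl.
have hb : 0 <= be <= 1 by rewrite b0 (le_trans _ ab)// lerDr.
rewrite coefB coefM coef_poly; case: ltnP => mK.
  rewrite -bincoef_convolution subr_ge0 le_eqVlt; apply/orP; left; apply/eqP.
  apply: eq_bigr => j _; rewrite !coef_poly.
  by rewrite (leq_ltn_trans (leq_subr _ _))// (leq_trans (ltn_ord j)).
rewrite subr0; apply: sumr_ge0 => j _; rewrite !coef_poly.
case: ltnP => jK; last by rewrite mul0r.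
case: ltnP => mjK; last by rewrite mulr0.
rewrite mulr_le0// bincoef_le0//; have := ltn_ord j; lia.
Qed.

End BinomialSeries.

(** * Fractional powers *)
Section FractionalPower.
Variables (R : realType) (X : completeNormedModType R[i]) (W : {linear X -> X}).
Hypothesis contrW : forall x, nrm (W x) <= nrm x.
Implicit Types (x y : X) (p q : {poly R}) (al be e : R).

Let rpol p x : X := pol W (map_poly (real_complex R) p) x.

Lemma rpolE p x : rpol p x = pol W (map_poly (real_complex R) p) x.
Proof. by []. Qed.

Lemma rpolB p q x : rpol (p - q) x = rpol p x - rpol q x.
Proof. by rewrite /rpol rmorphB polB. Qed.

Lemma rpolM p q x : rpol (p * q) x = rpol p (rpol q x).
Proof. by rewrite /rpol rmorphM polM. Qed.

Lemma rpol1 x : rpol 1 x = x.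
Proof. by rewrite /rpol rmorph1 -polyC1 polC scale1r. Qed.

Lemma rpol_linear p : linear (rpol p).
Proof. exact: pol_is_linear. Qed.

(** For nonnegative coefficients the l1-norm is the value at [1]. *)
Lemma nrm_rpol p x : nneg_coefs p -> nrm (rpol p x) <= p.[1] * nrm x.
Proof.
move=> p0; rewrite /rpol /pol horner_coef.
rewrite size_map_inj_poly ?rmorph0//; last exact: complexI.
rewrite (le_trans (nrm_sum _ _ _))// mulr_suml ler_sum// => i _.
rewrite nrmZ coef_map /= cabs_real ger0_norm// expr1n mulr1 ler_wpM2l//.
by elim: (val i) => //= n; apply: le_trans.
Qed.

Let S al K x : X := rpol (bintrunc al K) x.

Lemma fracpow_exists al x : 0 < al <= 1 ->
  exists l, forall K, nrm (S al K x - l) <= bintail al K * nrm x.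
Proof.
move=> /andP[a0 a1]; have al01 : 0 <= al <= 1 by rewrite ltW.
have x1 : 0 < nrm x + 1 by rewrite ltr_wpDl ?nrm_ge0.
have diff K L : (K <= L)%N -> nrm (S al K x - S al L x) <= bintail al K * nrm x.
  move=> KL; rewrite -rpolB (le_trans (nrm_rpol _ (nneg_bintrunc_sub al01 KL)))//.
  rewrite ler_wpM2r ?nrm_ge0// hornerD hornerN !bintrunc_at1 gerBl.
  by case/andP: (bintail_itv L al01).
have [|l hl] := @nrm_complete _ _ (fun K => S al K x).
  move=> e e0; have [||K hK] := @bintail_small _ al (e / 2 / (nrm x + 1)).
  - by rewrite a0.
  - by rewrite !divr_gt0.
  exists K => m n Km Kn; rewrite -(subrKA (S al K x)) (le_trans (nrmD _ _))//.
  rewrite nrm_distC; have := diff K m Km; have := diff K n Kn.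
  have : bintail al K * nrm x <= e / 2.
    rewrite (le_trans (_ : _ <= bintail al K * (nrm x + 1)))//.
      by rewrite ler_wpM2l ?lerDl//; case/andP: (bintail_itv K al01).
    by rewrite -ler_pdivlMr.
  by move=> *; lra.
exists l => K; apply/ler_addgt0Pr => e e0; have [L hL] := hl e e0.
rewrite -(subrKA (S al (maxn K L) x)) (le_trans (nrmD _ _))// lerD//.
  by rewrite diff// leq_maxl.
by rewrite hL// leq_maxr.
Qed.

(** [(I - W)^al], as the sum of the binomial series. *)
Definition fracpow al x : X :=
  xget 0 [set l | forall K, nrm (S al K x - l) <= bintail al K * nrm x].

Lemma fracpowP al x K : 0 < al <= 1 ->
  nrm (S al K x - fracpow al x) <= bintail al K * nrm x.
Proof.
move=> ha; rewrite /fracpow; case: xgetP => [l _ //|].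
by have [l hl] := fracpow_exists x ha => /(_ l) []; exact: hl.
Qed.

(** Identification principle: the fractional power is determined by any estimate
    in terms of the tails. *)
Lemma fracpow_approx al x (u : X) (C : R) : 0 < al <= 1 ->
  0 <= C ->
  (forall K, nrm (u - S al K x) <= C * bintail al K) -> u = fracpow al x.
Proof.
move=> ha C0 hu; apply/eqP; rewrite -subr_eq0; apply/eqP.
apply: (@nrm_small _ _ _ (C + nrm x)) => e e0.
have [K hK] := bintail_small ha e0.
rewrite -(subrKA (S al K x)) (le_trans (nrmD _ _))// mulrDl lerD//.
  by rewrite (le_trans (hu K))// ler_wpM2l.
by rewrite (le_trans (fracpowP x K ha))// mulrC ler_wpM2l ?nrm_ge0.
Qed.

Lemma fracpow_linear al : 0 < al <= 1 -> linear (fracpow al).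
Proof.
move=> ha a x y; apply/esym/(@fracpow_approx _ _ _ (cabs a * nrm x + nrm y)) => //.
  by rewrite addr_ge0 ?mulr_ge0 ?cabs_ge0 ?nrm_ge0.
move=> K; rewrite /S rpol_linear opprD addrACA -scalerBr (le_trans (nrmD _ _))//.
rewrite nrmZ mulrDl lerD//.
  rewrite -mulrA ler_wpM2l ?cabs_ge0// nrm_distC [leRHS]mulrC; exact: fracpowP.
by rewrite nrm_distC [leRHS]mulrC; exact: fracpowP.
Qed.

Lemma nrm_sub_rpol al K x : 0 < al <= 1 -> nrm (x - S al K x) <= nrm x.
Proof.
move=> /andP[a0 a1]; have al01 : 0 <= al <= 1 by rewrite ltW.
rewrite -{1}[x]rpol1 -rpolB (le_trans (nrm_rpol _ (nneg_one_sub_bintrunc K al01)))//.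
rewrite hornerD hornerN bintrunc_at1 hornerC ler_piMl ?nrm_ge0// gerBl.
by case/andP: (bintail_itv K al01).
Qed.

Lemma nrm_sub_fracpow al x : 0 < al <= 1 -> nrm (x - fracpow al x) <= nrm x.
Proof.
move=> ha; apply/ler_addgt0Pr => e e0.
have x1 : 0 < nrm x + 1 by rewrite ltr_wpDl ?nrm_ge0.
have [|K hK] := @bintail_small _ al (e / (nrm x + 1)) ha; first by rewrite divr_gt0.
rewrite -(subrKA (S al K x)) (le_trans (nrmD _ _))// lerD ?nrm_sub_rpol//.
rewrite (le_trans (fracpowP x K ha))// (le_trans (_ : _ <= bintail al K * (nrm x + 1)))//.
  have /andP[a0 a1] := ha.
  rewrite ler_wpM2l ?lerDl//; have /andP[] // : 0 <= bintail al K <= 1.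
  by rewrite bintail_itv// ltW.
by rewrite -ler_pdivlMr.
Qed.

(** The product of the two truncations differs from the truncation for [al + be]
    by a polynomial with nonnegative coefficients, whose value at [1] is at most
    the tail for [al]. *)
Lemma fracpowD al be x : 0 < al -> 0 < be -> al + be <= 1 ->
  fracpow al (fracpow be x) = fracpow (al + be) x.
Proof.
move=> a0 b0 ab.
have ha : 0 < al <= 1 by rewrite a0 (le_trans _ ab)// lerDl ltW.
have hb : 0 < be <= 1 by rewrite b0 (le_trans _ ab)// lerDr ltW.
have hab : 0 < al + be <= 1 by rewrite addr_gt0.
have w (c : R) : 0 < c <= 1 -> 0 <= c <= 1 by move=> /andP[/ltW-> ->].
apply/eqP; rewrite -subr_eq0; apply/eqP.
apply: (@nrm_small _ _ _ (nrm (fracpow be x) + 4 * nrm x)) => e e0.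
have [K1 h1] := bintail_small ha e0; have [K2 h2] := bintail_small hb e0.
have [K3 h3] := bintail_small hab e0.
pose K := maxn K1 (maxn K2 K3).
have {}h1 : bintail al K <= e.
  by rewrite (le_trans (bintail_decr (w _ ha) _) h1)// leq_maxl.
have {}h2 : bintail be K <= e.
  by rewrite (le_trans (bintail_decr (w _ hb) _) h2)// leq_max leq_maxl orbT.
have {}h3 : bintail (al + be) K <= e.
  by rewrite (le_trans (bintail_decr (w _ hab) _) h3)// !leq_max leqnn !orbT.
have e1 : nrm (fracpow al (fracpow be x) - S al K (fracpow be x)) <= e * nrm (fracpow be x).
  by rewrite nrm_distC (le_trans (fracpowP _ K ha))// ler_wpM2r ?nrm_ge0.
have e2 : nrm (S al K (fracpow be x) - S al K (S be K x)) <= 2 * (e * nrm x).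
  have -> : S al K (fracpow be x) - S al K (S be K x) = S al K (fracpow be x - S be K x).
    by rewrite /S addrC -scaleN1r -rpol_linear scaleN1r addrC.
  set v := fracpow be x - S be K x.
  have hv : nrm v <= e * nrm x.
    by rewrite nrm_distC (le_trans (fracpowP x K hb))// ler_wpM2r ?nrm_ge0.
  have := nrm_sub_rpol K v ha; have := nrmB v (v - S al K v).
  by rewrite opprB addrC subrK => *; lra.
have e3 : nrm (S al K (S be K x) - S (al + be) K x) <= e * nrm x.
  rewrite /S -rpolM -rpolB.
  rewrite (le_trans (nrm_rpol _ (nneg_bintrunc_mul K (ltW a0) (ltW b0) ab)))//.
  rewrite ler_wpM2r ?nrm_ge0// hornerD hornerN hornerM !bintrunc_at1.
  have /andP[t1 t2] := bintail_itv K (w _ ha).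
  have /andP[t3 t4] := bintail_itv K (w _ hb).
  have /andP[t5 t6] := bintail_itv K (w _ hab).
  rewrite (le_trans _ h1)// lerBlDr (le_trans (ler_piMr _ t4))// lerDl//.
have e4 : nrm (S (al + be) K x - fracpow (al + be) x) <= e * nrm x.
  by rewrite (le_trans (fracpowP x K hab))// ler_wpM2r ?nrm_ge0.
rewrite -(subrKA (S al K (fracpow be x))) (le_trans (nrmD _ _))//.
rewrite mulrDl [nrm _ * e]mulrC lerD//.
rewrite -(subrKA (S al K (S be K x))) (le_trans (nrmD _ _))//.
have : nrm (S al K (S be K x) - fracpow (al + be) x) <= e * nrm x + e * nrm x.
  by rewrite -(subrKA (S (al + be) K x)) (le_trans (nrmD _ _))// lerD.
by move=> e5; lra.
Qed.

Lemma fracpow1 x : fracpow 1 x = x - W x.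
Proof.
have h1 : 0 < (1 : R) <= 1 by rewrite ltr01 /=.
have := fracpowP x 1 h1; rewrite bintailS mulr1n divr1 subrr mulr0 mul0r.
move=> /nrm_le0/eqP; rewrite subr_eq0 => /eqP <-.
rewrite /S; have -> : bintrunc (1 : R) 1 = 1 - 'X.
  apply/polyP => -[|[|i]]; rewrite coef_poly coefB coef1 coefX //= ?subr0//.
    by rewrite !sub0r mul1r divr1.
by rewrite rpolB rpol1 rpolE map_polyX -['X]expr1 polXn.
Qed.

Lemma fracpow_comm (T : {linear X -> X}) al x : continuous T ->
  (forall y, T (W y) = W (T y)) -> 0 < al <= 1 ->
  fracpow al (T x) = T (fracpow al x).
Proof.
move=> /continuous_boundedP[B B0 hB] TW ha; apply/esym.
apply: (@fracpow_approx _ _ _ (B * nrm x)) => //; first by rewrite mulr_ge0 ?nrm_ge0.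
move=> K; have -> : S al K (T x) = T (S al K x).
  rewrite /S /rpol /pol linear_sum; apply: eq_bigr => i _; rewrite [RHS]linearZ.
  by congr (_ *: _); elim: (val i) => //= n ->; rewrite TW.
rewrite -linearB (le_trans (hB _))// -mulrA ler_wpM2l// nrm_distC mulrC.
exact: fracpowP.
Qed.

(** A truncation minus its value at [1] is divisible by [1 - u], and that value
    tends to zero, so the fractional power maps into the closed range of
    [I - W]. *)
Lemma fracpow_range al x e : 0 < al <= 1 -> 0 < e ->
  exists v, nrm (fracpow al x - (v - W v)) <= e.
Proof.
move=> ha e0; have x1 : 0 < 2 * (nrm x + 1) by rewrite mulr_gt0// ltr_wpDl ?nrm_ge0.
have [|K hK] := @bintail_small _ al (e / (2 * (nrm x + 1))) ha; first by rewrite divr_gt0.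
have : root (bintrunc al K - (bintail al K)%:P) 1.
  by rewrite rootE hornerD hornerN hornerC bintrunc_at1 subrr.
move=> /factor_theorem[q hq].
exists (- rpol q x).
have /andP[t0 _] : 0 <= bintail al K <= 1 by case/andP: ha => /ltW a0 a1; rewrite bintail_itv ?a0.
have e1 : S al K x - (bintail al K)%:C *: x = - rpol q x - W (- rpol q x).
  have -> : (bintail al K)%:C *: x = rpol (bintail al K)%:P x.
    by rewrite rpolE map_polyC polC.
  rewrite -rpolB hq mulrC rpolM rpolB rpolE map_polyX -['X]expr1 polXn.
  by rewrite rpol1 linearN opprK addrC.
rewrite -e1 opprB addrCA (le_trans (nrmD _ _))// nrmZ cabs_real ger0_norm//.
rewrite nrm_distC; have := fracpowP x K ha.
have : bintail al K * (2 * (nrm x + 1)) <= e by rewrite -ler_pdivlMr.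
by move=> *; lra.
Qed.

End FractionalPower.

Section Roots.
Variables (R : realType) (X : completeNormedModType R[i]).

(** The powers of the root are themselves fractional powers, which is why each
    of them, up to the [n]-th, is within distance [1] of the identity. *)
Lemma accretive_root (T : {linear X -> X}) n : continuous T -> (0 < n)%N ->
  (forall x, nrm (x - iter n T x) <= nrm x) ->
  exists U : {linear X -> X}, [/\ continuous U,
    forall p, (0 < p <= n)%N -> forall x, nrm (x - iter p U x) <= nrm x,
    forall x, iter n U x = iter n T x,
    forall x, U (T x) = T (U x) &
    forall x (e : R), 0 < e -> exists v, nrm (U x - iter n T v) <= e].
Proof.
move=> cT n0 hT; pose w x := x - iter n T x.
have wl : linear w.
  by move=> a x y; rewrite /w iter_linear opprD addrACA -scalerBr.
pose W : {linear X -> X} := HB.pack w (GRing.isLinear.Build R[i] X X _ w wl).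
have hW x : nrm (W x) <= nrm x by exact: hT.
have nR : 0 < n%:R :> R by rewrite ltr0n.
have frac p : (0 < p <= n)%N -> 0 < (p%:R / n%:R : R) <= 1.
  by move=> /andP[p0 pn]; rewrite divr_gt0 ?ltr0n//= ler_pdivrMr// mul1r ler_nat.
have n1 : (0 < 1 <= n)%N by [].
pose u := fracpow W (1 / n%:R).
have ul : linear u by apply: (fracpow_linear hW (frac 1%N n1)).
pose U : {linear X -> X} := HB.pack u (GRing.isLinear.Build R[i] X X _ u ul).
have iterU p : (0 < p <= n)%N -> forall x, iter p U x = fracpow W (p%:R / n%:R) x.
  elim: p => // -[|p] IH /andP[_ pn] x; first by [].
  rewrite iterS IH ?(ltnW pn)// -[U _]/(fracpow W (1 / n%:R) _) fracpowD//.
  - by rewrite -mulrDl nat1r.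
  - by rewrite divr_gt0.
  - by rewrite divr_gt0 // ltr0n.
  - by have /andP[_] := frac p.+2 pn; rewrite -mulrDl nat1r.
exists U; split.
- apply/continuous_boundedP; exists 2 => // x.
  have := nrm_sub_fracpow hW x (frac 1%N n1); rewrite -[fracpow _ _ _]/(U x).
  by have := nrmB x (x - U x); rewrite opprB addrC subrK => *; lra.
- by move=> p pn x; rewrite iterU// nrm_sub_fracpow// frac.
- move=> x; rewrite iterU ?n0 ?leqnn// divff ?gt_eqF// fracpow1//.
  by rewrite opprB addrC subrK.
- move=> x; apply: (fracpow_comm hW x cT _ (frac 1%N n1)) => y.
  by rewrite /= /w linearB -iterSr.
- move=> x e e0; have [v hv] := fracpow_range hW x (frac 1%N n1) e0.
  by exists v; move: hv; rewrite [W v]/(v - iter n T v) subKr.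
Qed.

End Roots.

(** * Uniqueness of accretive roots *)
Section RootsOfUnity.
Variable R : realType.
Implicit Types (phi : R).

Lemma cis_neq1 phi : 0 < phi < 2 * pi -> cis phi != 1.
Proof.
move=> /andP[p0 p1]; apply/eqP => -[c1 _].
have := @sin_gt0_pi R (phi / 2); rewrite divr_gt0//= ltr_pdivrMr// mulrC p1.
move=> /(_ isT) s0.
have : cos (phi / 2 + phi / 2) = 1 by rewrite -splitr.
rewrite cosD -!expr2; have := cos2Dsin2 (phi / 2).
have : 0 < sin (phi / 2) ^+ 2 by rewrite exprn_gt0.
by move=> *; lra.
Qed.

Lemma primitive_cis n : (0 < n)%N -> n.-primitive_root (cis (2 * pi / n%:R) : R[i]).
Proof.
move=> n0; have nR : 0 < n%:R :> R by rewrite ltr0n.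
apply/andP; split => //; apply/forallP => i; apply/eqP; rewrite unity_rootE cisX.
have pi0 : 0 < 2 * pi :> R by rewrite mulr_gt0// pi_gt0.
apply/eqP/eqP => [|->]; last first.
  by rewrite mulrC divfK ?gt_eqF// mulr_natl /cis cos2pi sin2pi.
move=> h; apply/eqP; move: (ltn_ord i); rewrite leq_eqVlt => /orP[//|ilt].
move/eqP: h; apply: contraTT => _; apply: cis_neq1; apply/andP; split.
  by rewrite mulr_gt0 ?ltr0n// divr_gt0.
by rewrite mulrA ltr_pdivrMr// mulrC ltr_pM2l// ltr_nat.
Qed.

Lemma sum_root_of_unity (F : fieldType) (w : F) n m : n.-primitive_root w ->
  \sum_(j < n) w ^+ (j * m) = if (n %| m)%N then n%:R else 0.
Proof.
move=> wn; have -> : \sum_(j < n) w ^+ (j * m) = \sum_(j < n) (w ^+ m) ^+ j.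
  by apply: eq_bigr => j _; rewrite mulnC exprM.
rewrite (prim_order_dvd wn); case: eqP => [->|/eqP wm].
  by rewrite (eq_bigr (fun=> 1)) ?sumr_const ?card_ord// => j _; rewrite expr1n.
apply: (@mulfI _ (w ^+ m - 1)); first by rewrite subr_eq0.
by rewrite mulr0 -subrX1 exprAC (prim_expr_order wn) expr1n subrr.
Qed.

(** The cosines of the powers of a nontrivial root of unity add up to zero and
    the zeroth one is [1], so one of the others is negative. *)
Lemma negative_cos phi n : (0 < n)%N -> cis phi ^+ n = 1 -> cis phi != 1 ->
  exists2 k, (0 < k <= n)%N & cos (k%:R * phi) < 0.
Proof.
move=> n0 hn h1; apply: contrapT => h.
have pos k : (0 < k <= n)%N -> 0 <= cos (k%:R * phi).
  by move=> kn; rewrite leNgt; apply/negP => c; apply: h; exists k.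
case: n => // n in n0 hn pos h *.
have : \sum_(j < n.+1) cis phi ^+ j = 0.
  apply: (@mulfI _ (cis phi - 1)); first by rewrite subr_eq0.
  by rewrite mulr0 -subrX1 hn subrr.
move=> /(congr1 (@complex.Re R)); rewrite raddf_sum /=.
rewrite big_ord_recl expr0 /=.
have : 0 <= \sum_(i < n) complex.Re (cis phi ^+ lift ord0 i).
  apply: sumr_ge0 => i _; rewrite lift0 cisX /=; apply: pos.
  by have := ltn_ord i; lia.
by move=> p0 /eqP; rewrite gt_eqF// ltr_pwDl.
Qed.

End RootsOfUnity.

Section RootUniqueness.
Variables (R : realType) (X : completeNormedModType R[i]).
Variables (T U : {linear X -> X}) (n : nat).
Hypotheses (cT : continuous T) (n0 : (0 < n)%N).
Hypothesis accT : forall x, nrm (x - T x) <= nrm x.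
Hypothesis secT : forall omega : R, 0 < omega ->
  exists2 c : R, 0 < c & forall z, z != 0 -> omega <= `|arg z| ->
    forall x, c * cabs z * nrm x <= nrm (z *: x - T x).
Hypothesis distU : forall p, (0 < p <= n)%N -> forall x, nrm (x - iter p U x) <= nrm x.
Hypothesis TU : forall x, U (T x) = T (U x).
Hypothesis TnUn : forall x, iter n U x = iter n T x.
Implicit Types (x y : X).

(** On the eigenspace the resolvent of [T] at [z] equals, up to the unimodular
    factor [cis phi], that of [U] at [cis phi * z]. The former is controlled off
    the positive axis and the latter near it, so together they cover every
    [z != 0]. *)
Lemma eigenvector_kernel (phi : R) y : cis phi ^+ n = 1 -> cis phi != 1 ->
  U y = cis phi *: T y -> T y = 0.
Proof.
move=> hn h1; have [k kn ck] := negative_cos n0 hn h1.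
have k0 : (0 < k)%N by case/andP: kn.
pose d := Num.min 1 (- cos (k%:R * phi) / 2).
have d0 : 0 < d by rewrite lt_min ltr01 divr_gt0// oppr_gt0.
have d1 : d <= 1 by rewrite ge_min lexx.
have dc : cos (k%:R * (0 + phi)) < - d.
  have : d <= - cos (k%:R * phi) / 2 by rewrite ge_min lexx orbT.
  by rewrite add0r; lra.
have [omega w0 hw] : exists2 omega : R, 0 < omega & forall t, `|t| < omega ->
    cos (k%:R * (t + phi)) <= - d.
  have ct : {for 0, continuous (fun t : R => cos (k%:R * (t + phi)))}.
    apply: continuous_comp; last exact: continuous_cos.
    apply: continuous_comp; last exact: mulrl_continuous.
    by apply: cvgD; [exact: cvg_id|exact: cvg_cst].
  have : \forall t \near (0 : R), cos (k%:R * (t + phi)) < - d := ct _ (lt_nbhsl dc).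
  move=> /nbhs_ballP[e /= e0 he]; exists e => // t te.
  by apply/ltW/he; rewrite -ball_normE /ball_ /= sub0r normrN.
have [c2 c20 hc2] := secT w0.
have n1 : (0 < 1 <= n)%N by rewrite n0.
have [c1 c10 hc1] := sectorial_bound k0 d0 (distU n1) (distU kn).
move=> hy; apply: (@liouville _ _ [set v | U v = cis phi *: T v] _ T (Num.min c1 c2)) => //.
- move=> a u v /= hu hv; by rewrite (linearP U) (linearP T) hu hv scalerDr !scalerA mulrC.
- by move=> v /= hv; rewrite TU hv linearZ /=.
- by rewrite lt_min c10.
move=> z z0 v /= hv.
have le_min (c c' m : R) : c <= c' -> 0 <= m -> c * cabs z * m <= c' * cabs z * m.
  by move=> cc m0; rewrite -!mulrA ler_wpM2r// mulr_ge0 ?cabs_ge0.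
have [wz|wz] := leP omega `|arg z|.
  apply: le_trans (hc2 z z0 wz v); rewrite le_min ?nrm_ge0//.
  by rewrite ge_min lexx orbT.
pose w := cis phi * z.
have cw : cabs w = cabs z by rewrite cabsM cabs_cis mul1r.
have w1 : w != 0 by rewrite -cabs_gt0 cw cabs_gt0.
have -> : nrm (z *: v - T v) = nrm (w *: v - U v).
  by rewrite hv /w -scalerA -scalerBr nrmZ cabs_cis mul1r.
apply: le_trans (hc1 w w1 _ v).
  by rewrite cw le_min ?nrm_ge0// ge_min lexx.
rewrite cw /w exprMn (polar_power _ z0) cisX mulrCA -cisD -mulrDr [phi + _]addrC.
apply: far_from_one; first by rewrite exprn_ge0 ?cabs_ge0.
  by rewrite d1 ltW.
exact: hw.
Qed.

(** Apply accretivity to [y / t + x] and let [t] tend to [0]. *)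
Lemma kernel_range_disjoint y x : T y = 0 -> nrm y <= nrm (y + T x).
Proof.
move=> Ty; apply/ler_addgt0Pr => e e0.
pose t := e / (2 * (nrm x + 1)).
have x1 : 0 < 2 * (nrm x + 1) by rewrite mulr_gt0// ltr_wpDl ?nrm_ge0.
have t0 : 0 < t by rewrite divr_gt0.
have tx : t * (2 * (nrm x + 1)) = e by rewrite divfK// gt_eqF.
have tn : t%:C != 0 by rewrite -cabs_gt0 cabs_real gtr0_norm.
have := accretive accT (t%:C^-1 *: y + x) (ltW t0).
rewrite [T (_ + _)]linearD [T (_ *: _)]linearZ /= Ty scaler0 add0r.
have -> : t * nrm (t%:C^-1 *: y + x) = nrm (y + t%:C *: x).
  have := nrmZ t%:C (t%:C^-1 *: y + x); rewrite cabs_real gtr0_norm// => <-.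
  by rewrite scalerDr scalerA divff// scale1r.
rewrite scalerDr scalerA divff// scale1r addrAC => h.
have h1 := nrmD (y + T x) (t%:C *: x).
have h2 := nrmB (y + t%:C *: x) (t%:C *: x).
move: h1 h2; rewrite addrK nrmZ cabs_real gtr0_norm// => h1 h2.
by move: t0 => t0'; lra.
Qed.

Hypothesis rangeU : forall x (e : R), 0 < e -> exists v, nrm (U x - iter n T v) <= e.

Lemma iter_comm p q x : iter p U (iter q T x) = iter q T (iter p U x).
Proof.
have h y : U (iter q T y) = iter q T (U y) by elim: q => //= q <-; rewrite TU.
by elim: p => //= p ->.
Qed.

(** For each [n]-th root of unity [w^-j] the discrete Fourier sum [y j] of the
    [U^k T^(n-1-k) x] lies in the kernel of [U - w^-j T], because
    [U^n = T^n]. By [eigenvector_kernel], [T] kills all of them except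
    [y 0], which the coefficients [w^(j(n-1)) - 1] suppress. Fourier inversion thus gives
    [T (U T^(n-2) x - T^(n-1) x) = 0], whence [T (U x - T x) = 0]; as [U x] is a
    limit of values of [T^n], the vector [U x - T x] lies in both the kernel and
    the closed range of [T]. *)
Lemma accretive_root_unique : (1 < n)%N -> forall x, U x = T x.
Proof.
move=> n1 x; pose w : R[i] := cis (2 * pi / n%:R).
have wn : n.-primitive_root w by exact: primitive_cis.
pose v k := iter k U (iter (n.-1 - k) T x).
pose y j := \sum_(k < n) w ^+ (j * k) *: v k.
have Ty j : (0 < j < n)%N -> T (y j) = 0.
  move=> /andP[j0 jn]; pose phi := - (j%:R * (2 * pi / n%:R) : R).
  have wj : cis phi * w ^+ j = 1 by rewrite cisX -cisD /phi addNr cis0.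
  have wj0 : w ^+ j != 0.
    by apply: contra_eq_neq wj => ->; rewrite mulr0 eq_sym oner_eq0.
  have phiE : cis phi = (w ^+ j)^-1 by rewrite -[LHS](mulfK wj0) wj mul1r.
  apply: (@eigenvector_kernel phi).
  - by rewrite phiE exprVn exprAC (prim_expr_order wn) expr1n invr1.
  - by rewrite phiE invr_eq1 -(prim_order_dvd wn) gtnNdvd.
  pose e k : X := w ^+ (j * k) *: iter k U (iter (n - k) T x).
  have step k : (k < n)%N ->
      U (w ^+ (j * k) *: v k) - cis phi *: T (w ^+ (j * k) *: v k) =
      cis phi *: (e k.+1 - e k).
    move=> kn; have Uv : U (v k) = iter k.+1 U (iter (n - k.+1) T x).
      by rewrite /v (_ : (n.-1 - k = n - k.+1)%N)//; lia.
    have Tv : T (v k) = iter k U (iter (n - k) T x).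
      rewrite /v -[T _]/(iter 1 T (iter k U _)) -iter_comm /= -iterS.
      by rewrite (_ : ((n.-1 - k).+1 = n - k)%N)//; lia.
    rewrite [U (_ *: _)]linearZ [T (_ *: _)]linearZ /= Uv Tv /e scalerBr.
    by congr (_ - _); rewrite scalerA phiE mulnS exprD mulKf.
  apply/eqP; rewrite -subr_eq0 /y (linear_sum U) (linear_sum T) scaler_sumr -sumrB /=.
  rewrite (eq_bigr (fun k : 'I_n => cis phi *: (e k.+1 - e k))); last first.
    by move=> k _; rewrite step.
  rewrite -scaler_sumr -(big_mkord xpredT (fun k => e k.+1 - e k)) telescope_sumr//.
  by rewrite /e muln0 subnn subn0 scale1r /= mulnC exprM (prim_expr_order wn)
     expr1n scale1r TnUn subrr scaler0.
pose D := iter 1 U (iter (n.-1 - 1) T x) - iter n.-1 T x.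
have DE : n%:R *: D = \sum_(j < n) (w ^+ (j * n.-1) - 1) *: y j.
  under eq_bigr do rewrite scaler_sumr.
  rewrite exchange_big /=.
  transitivity (\sum_(k < n) ((if (n %| k + n.-1)%N then n%:R else 0) -
                              (if (n %| k)%N then n%:R else 0 : R[i])) *: v k).
    have shift k : (0 < k)%N -> (n %| k + n.-1)%N = (n %| k.-1)%N.
      by move=> k0; rewrite (_ : (k + n.-1 = k.-1 + n)%N) ?dvdn_addl//; lia.
    have d01 : Ordinal n1 != Ordinal n0 by [].
    rewrite (bigD1 (Ordinal n0))//= (bigD1 (Ordinal n1))//= big1 ?addr0; last first.
      move=> k /andP[k0 k1]; have kn := ltn_ord k.
      have k2 : (1 < k)%N.
        by move: k0 k1; rewrite -!val_eqE /= => *; lia.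
      rewrite shift; last by lia.
      by rewrite !gtnNdvd ?subr0 ?scale0r//; lia.
    rewrite add0n dvdn0 shift// dvdn0 !gtnNdvd ?sub0r ?subr0//; try by lia.
    by rewrite scaleNr addrC /D scalerBr /v subn0.
  apply: eq_bigr => k _; rewrite -!(sum_root_of_unity _ wn) -sumrB scaler_suml.
  apply: eq_bigr => j _; rewrite scalerA mulrBl mul1r -exprD mulnDr addnC //.
have TD : T D = 0.
  have : T (n%:R *: D) = 0.
    rewrite DE (linear_sum T) big1// => j _; rewrite [T (_ *: _)]linearZ /=.
    have [->|j0] := eqVneq (j : nat) 0%N; first by rewrite mul0n expr0 subrr scale0r.
    by rewrite Ty ?scaler0// lt0n j0 /=.
  rewrite [T (_ *: _)]linearZ /= => /eqP.
  by rewrite scaler_eq0 pnatr_eq0 (gtn_eqF n0) => /eqP.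
have Ty0 : T (U x - T x) = 0.
  apply: (@kernel_iter _ _ _ accT n.-1); first by lia.
  rewrite -TD /D /= [T (_ - _)]linearB /= -TU.
  have iterB p a b : iter p T (a - b) = iter p T a - iter p T b.
    by elim: p => //= p ->; rewrite linearB.
  rewrite iterB -[U x]/(iter 1 U x) -iter_comm -!iterSr -iterS.
  by rewrite (_ : ((n.-1 - 1).+1 = n.-1)%N)//; lia.
apply/eqP; rewrite -subr_eq0; apply/eqP; apply: (@nrm_small _ _ _ 1) => e e0.
have [u hu] := rangeU x e0.
have := kernel_range_disjoint (x - iter n.-1 T u) Ty0.
have -> : U x - T x + T (x - iter n.-1 T u) = U x - iter n T u.
  by rewrite linearB /= -iterS prednK// addrA subrK.
by rewrite mul1r => /le_trans; apply.
Qed.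

End RootUniqueness.

(** * Powers of a sectorial operator and the Ritt condition *)
Section PowersFromSector.
Variables (R : realType) (X : completeNormedModType R[i]).

Lemma sectorial_root_unit_distance (T : {linear X -> X}) n : continuous T -> (0 < n)%N ->
  (forall x, nrm (x - T x) <= nrm x) ->
  (forall x, nrm (x - iter n T x) <= nrm x) ->
  (forall omega : R, 0 < omega ->
    exists2 c : R, 0 < c & forall z, z != 0 -> omega <= `|arg z| ->
      forall x, c * cabs z * nrm x <= nrm (z *: x - T x)) ->
  forall m, (0 < m <= n)%N -> forall x, nrm (x - iter m T x) <= nrm x.
Proof.
move=> cT n0 accT hT secT m mn x.
have [U [cU distU TnUn TU rangeU]] := accretive_root cT n0 hT.
have [n1|n1] := leqP n 1.
  by rewrite (_ : m = 1%N) //; lia.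
have UT : U =1 T by apply: (@accretive_root_unique _ _ T U n).
by rewrite -(eq_iter UT); exact: distU.
Qed.

End PowersFromSector.

Section RittBound.
Variables (R : realType).
Implicit Types (t : R).

(** [|e^(i t) - 1| = 2 |sin (t / 2)|]. *)
Lemma dist_cis1 t : cabs (cis t - 1) <= `|t|.
Proof.
have sin_le (s : R) : 0 <= s -> `|sin s| <= s.
  rewrite le_eqVlt => /orP[/eqP<-|s0]; first by rewrite sin0 normr0.
  have [|c _] := @MVT R sin cos 0 s s0 (fun x _ => is_derive_sin x).
    by apply: continuous_subspaceT => x; exact: continuous_sin.
  rewrite sin0 !subr0 => ->; rewrite normrM (gtr0_norm s0) ler_piMl ?cos_max//.
  exact: ltW.
rewrite -(@ler_pXn2r _ 2) ?nnegrE ?cabs_ge0//.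
have := cabs_sub1_sqr 1 t; rewrite mul1r => ->.
rewrite -cos_norm (splitr `|t|) cosD -!expr2.
have h0 : 0 <= `|t| / 2 by rewrite divr_ge0.
have h1 : sin (`|t| / 2) ^+ 2 <= (`|t| / 2) ^+ 2.
  by rewrite -real_normK ?num_real// lerXn2r ?nnegrE// sin_le.
have := cos2Dsin2 (`|t| / 2); set c := cos _; set s := sin _ in h1 * => h2.
have : (`|t| / 2) ^+ 2 = `|t| ^+ 2 / 4 by field.
by move=> h3; lra.
Qed.

Lemma pi4_itv : 0 < (pi / 4 : R) < pi / 2.
Proof. by have := pi_gt0 R => p0; apply/andP; split; lra. Qed.

(** The least [m] with [m |t| >= 3 pi / 4] overshoots by less than [pi / 4]. *)
Lemma multiple_near_pi t : t != 0 -> `|t| < pi / 4 ->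
  exists m, [/\ (0 < m)%N, m%:R * `|t| <= pi & cos (m%:R * t) <= - cos (pi / 4)].
Proof.
move=> t0 t4; have p0 := pi_gt0 R; have at0 : 0 < `|t| by rewrite normr_gt0.
have ex : exists m : nat, 3 * pi / 4 <= m%:R * `|t|.
  exists (Num.truncn (3 * pi / 4 / `|t|)).+1.
  by rewrite -ler_pdivrMr// ltW// truncnS_gt.
have [m hm hmin] := ex_minnP ex.
have m0 : (0 < m)%N.
  by rewrite lt0n; apply: contraTneq hm => ->; rewrite mul0r -ltNge; lra.
have mle : m%:R * `|t| <= pi.
  have : ~~ (3 * pi / 4 <= m.-1%:R * `|t|).
    by apply/negP => /hmin; lia.
  rewrite -ltNge => h; rewrite -(prednK m0) -natr1 mulrDl mul1r; lra.
exists m; split => //.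
have -> : cos (m%:R * t) = cos (m%:R * `|t|).
  by rewrite -cos_norm normrM ger0_norm.
have -> : - cos (pi / 4) = cos (3 * pi / 4) :> R.
  rewrite (_ : 3 * pi / 4 = - (pi / 4) + pi); last by field.
  by rewrite cosDpi cosN.
have [->//|ne] := eqVneq (3 * pi / 4) (m%:R * `|t|).
rewrite ltW// ltr_cos ?in_itv/=; first by rewrite lt_neqAle ne.
  by apply/andP; split=> //; lra.
by apply/andP; split; lra.
Qed.

Variables (X : completeNormedModType R[i]) (T : {linear X -> X}).
Hypothesis distT : forall m, (0 < m)%N -> forall x, nrm (x - iter m T x) <= nrm x.

Lemma power_bounded m x : nrm (iter m T x) <= 2 * nrm x.
Proof.
case: m => [|m]; first by have := nrm_ge0 x => /= h; lra.
have := distT (ltn0Sn m) x; have := nrmB x (x - iter m.+1 T x).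
by rewrite subKr => *; lra.
Qed.

Lemma power_lower z m x : (0 < m)%N ->
  (cabs (z ^+ m - 1) - 1) * nrm x <=
  2 * (\sum_(i < m) cabs z ^+ (m.-1 - i)) * nrm (z *: x - T x).
Proof.
move=> m0; apply: (le_trans (unit_distance_lower _ (distT m0 x))).
rewrite sub_powerr (le_trans (nrm_sum _ _ _))// -mulrA mulrCA mulr_suml ler_sum// => i _.
by rewrite nrmZ cabsX ler_wpM2l ?exprn_ge0 ?cabs_ge0// power_bounded.
Qed.

(** For [|z|^m >= 4] both [|z^m - 1| - 1] and [(|z| - 1) * \sum_(i < m) |z|^i] are
    of the order of [|z|^m]. *)
Lemma radial_lower z x : 1 < cabs z ->
  (cabs z - 1) * nrm x <= 4 * nrm (z *: x - T x).
Proof.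
set r := cabs z => r1; have [m m0 hm] := expr_unbounded 4 r1.
have r0 : 0 < r by rewrite (lt_trans _ r1).
have rm : 0 < r ^+ m by rewrite exprn_gt0.
have := power_lower z x m0; rewrite -/r => h.
have h1 : r ^+ m / 2 <= cabs (z ^+ m - 1) - 1.
  have := cabsB (z ^+ m - 1) (-1); rewrite opprK subrK cabsN cabs1 cabsX -/r => h1; lra.
have geo : (r - 1) * \sum_(i < m) r ^+ (m.-1 - i) <= r ^+ m.
  rewrite (reindex_inj rev_ord_inj)/=.
  rewrite (eq_bigr (fun i : 'I_m => r ^+ i)); last first.
    by move=> i _; congr (_ ^+ _); have := ltn_ord i; lia.
  by rewrite -subrX1 gerBl.
have h2 : r ^+ m / 2 * ((r - 1) * nrm x) <= 2 * r ^+ m * nrm (z *: x - T x).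
  rewrite mulrCA (le_trans (y := (r - 1) * (2 * (\sum_(i < m) r ^+ (m.-1 - i)) * nrm (z *: x - T x))))//.
    rewrite ler_wpM2l ?subr_ge0 ?(ltW r1)// (le_trans _ h)//.
    by rewrite ler_wpM2r ?nrm_ge0.
  rewrite !mulrA ler_wpM2r ?nrm_ge0// [_ * 2]mulrC -!mulrA ler_wpM2l//.
by rewrite -(ler_pM2l rm); lra.
Qed.

(** For [m |arg z|] near [pi] the factor [|z^m - 1| - 1] is of the order of
    [|z|^m], while the cofactor of [z - T] in [z^m - T^m] has norm at most
    [2 m |z|^(m-1)] and [m |arg z| <= pi]. *)
Lemma angular_lower z x : 1 < cabs z -> `|arg z| < pi / 4 ->
  cos (pi / 4) * (cabs z * `|arg z|) * nrm x <= 2 * pi * nrm (z *: x - T x).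
Proof.
set r := cabs z => r1 az; have p0 := pi_gt0 R.
have [-> |a0] := eqVneq (arg z) 0.
  by rewrite normr0 !(mulr0, mul0r) !mulr_ge0 ?nrm_ge0// ltW.
have r0 : 0 < r by rewrite (lt_trans _ r1).
have z0 : z != 0 by rewrite -cabs_gt0.
have [m [m0 mpi mcos]] := multiple_near_pi a0 az.
have d0 : 0 < cos (pi / 4 : R).
  by apply: cos_gt0_pihalf; have := pi4_itv; move=> /andP[? ?]; apply/andP; split; lra.
have h1 : cos (pi / 4) * r ^+ m <= cabs (z ^+ m - 1) - 1.
  rewrite polar_power//; apply: far_from_one => //; first by rewrite exprn_ge0// ltW.
  by rewrite cos_le1 ltW.
have := power_lower z x m0; rewrite -/r => h.
have h2 : \sum_(i < m) r ^+ (m.-1 - i) <= m%:R * r ^+ m.-1.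
  rewrite (le_trans (y := \sum_(i < m) r ^+ m.-1))//; last first.
    by rewrite sumr_const card_ord -[leLHS]mulr_natl.
  by apply: ler_sum => i _; rewrite ler_eXn2l ?leq_subr// .
have rm : 0 < r ^+ m.-1 by rewrite exprn_gt0.
set y := nrm (z *: x - T x) in h *; have y0 : 0 <= y by exact: nrm_ge0.
have h3 : cos (pi / 4) * r * nrm x <= 2 * m%:R * y.
  rewrite -(ler_pM2r rm).
  have -> : cos (pi / 4) * r * nrm x * r ^+ m.-1 = cos (pi / 4) * r ^+ m * nrm x.
    by rewrite -{2}(prednK m0) exprS; ring.
  apply: (le_trans (ler_wpM2r (nrm_ge0 x) h1)); apply: (le_trans h).
  have -> : 2 * m%:R * y * r ^+ m.-1 = 2 * (m%:R * r ^+ m.-1) * y by ring.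
  by rewrite ler_wpM2r// ler_wpM2l.
have -> : cos (pi / 4) * (r * `|arg z|) * nrm x = `|arg z| * (cos (pi / 4) * r * nrm x) by ring.
apply: (le_trans (ler_wpM2l (normr_ge0 _) h3)).
have -> : `|arg z| * (2 * m%:R * y) = 2 * (m%:R * `|arg z|) * y by ring.
by rewrite ler_wpM2r// ler_wpM2l.
Qed.

(** Combine the radial and the angular estimates through
    [|z - 1| <= (|z| - 1) + |z| |arg z|]. *)
Lemma ritt_lower (c : R) : 0 < c ->
  (forall z, z != 0 -> pi / 4 <= `|arg z| ->
    forall x, c * cabs z * nrm x <= nrm (z *: x - T x)) ->
  exists2 d : R, 0 < d & forall z, 1 < cabs z ->
    forall x, d * cabs (z - 1) * nrm x <= nrm (z *: x - T x).
Proof.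
move=> c0 hc; have p0 := pi_gt0 R.
have d0 : 0 < cos (pi / 4 : R).
  by apply: cos_gt0_pihalf; have := pi4_itv; move=> /andP[? ?]; apply/andP; split; lra.
pose K := 4 + 2 * pi / cos (pi / 4) + 2 / c.
have K1 : 0 < 2 * pi / cos (pi / 4 : R) by rewrite divr_gt0// mulr_gt0.
have K2 : 0 < 2 / c by rewrite divr_gt0.
have K0 : 0 < K by rewrite /K; lra.
exists K^-1; first by rewrite invr_gt0.
move=> z z1 x; rewrite -mulrA ler_pdivrMl//.
have r0 : 0 < cabs z by rewrite (lt_trans _ z1).
have z0 : z != 0 by rewrite -cabs_gt0.
set y := nrm (z *: x - T x); have y0 : 0 <= y by exact: nrm_ge0.
have x0 := nrm_ge0 x.
have KE : K * y = 4 * y + 2 * pi / cos (pi / 4) * y + 2 * (y / c).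
  by rewrite /K; field; rewrite !gt_eqF.
have [az|az] := leP (pi / 4) `|arg z|.
  have := hc z z0 az x; rewrite -/y => h.
  have h1 : cabs z * nrm x <= y / c by rewrite ler_pdivlMr// mulrC mulrA.
  have h2 : cabs (z - 1) * nrm x <= 2 * cabs z * nrm x.
    by rewrite ler_wpM2r// (le_trans (cabsB _ _))// cabs1; lra.
  have := mulr_ge0 (ltW K1) y0 => h3.
  by rewrite (le_trans h2)// KE; lra.
have h1 := radial_lower x z1; have h2 := angular_lower x z1 az.
have h3 : cabs (z - 1) <= (cabs z - 1) + cabs z * `|arg z|.
  rewrite {1}(polar z0).
  have -> : (cabs z)%:C * cis (arg z) - 1 =
      (cabs z - 1)%:C + (cabs z)%:C * (cis (arg z) - 1).
    have -> : (cabs z - 1)%:C = (cabs z)%:C - 1 by rewrite rcD rmorphN.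
    ring.
  rewrite (le_trans (cabsD _ _))// cabsM !cabs_real.
  rewrite ger0_norm ?subr_ge0 ?(ltW z1)// lerD2l ger0_norm ?(ltW r0)//.
  by rewrite ler_wpM2l ?(ltW r0)// dist_cis1.
apply: (le_trans (ler_wpM2r x0 h3)).
have h4 : cabs z * `|arg z| * nrm x <= 2 * pi / cos (pi / 4) * y.
  by rewrite [leRHS]mulrAC ler_pdivlMr// mulrC mulrA.
rewrite [leLHS]mulrDl KE.
have := mulr_ge0 (ltW K2) y0; rewrite mulrAC -mulrA => h6; lra.
Qed.

End RittBound.

(** * Separating blocks *)
Section Blocks.

Lemma increasing_enumeration (N : set nat) : infinite_set N ->
  exists2 e : nat -> nat, {homo e : i j / (i < j)%N} & range e = N.
Proof.
move=> /infinite_unbounded infN.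
have /choice[nx hnx] : forall K, exists m,
    [/\ N m, (K <= m)%N & forall n, N n -> (K <= n)%N -> (m <= n)%N].
  move=> K; have ex : exists n, `[< N n >] && (K <= n)%N.
    by have [n Nn Kn] := infN K; exists n; rewrite Kn andbT; apply/asboolP.
  have [m /andP[/asboolP Nm Km] hm] := ex_minnP ex.
  by exists m; split=> // n Nn Kn; apply: hm; rewrite Kn andbT; apply/asboolP.
pose e k := iter k (fun m => nx m.+1) (nx 0%N).
have he : {homo e : i j / (i < j)%N}.
  by apply: homo_ltn => [? ? ? |k]; [exact: ltn_trans|have [] := hnx (e k).+1].
exists e => //; apply/seteqP; split=> [_ [[|k] _ <-]|n Nn].
- by have [] := hnx 0%N.
- by have [] := hnx (e k).+1.
have id_le k : (k <= e k)%N.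
  by elim: k => // k IH; apply: (leq_ltn_trans IH); exact: he.
have [k] : exists k, (n < e k)%N by exists n.+1; exact: id_le.
elim: k => [|k IH].
  move=> hk; have [_ _ /(_ n Nn (leq0n n)) h] := hnx 0%N.
  by have := leq_trans hk h; rewrite ltnn.
move=> hk; have [nk|nk|nk] := ltngtP n (e k).
- exact: IH.
- have [_ _ /(_ n Nn nk) h] := hnx (e k).+1.
  by have := leq_trans hk h; rewrite ltnn.
- by exists k.
Qed.

Lemma blocks_gap j n : blocks n -> (2 ^ 2 ^ j + j < n)%N -> (2 ^ 2 ^ j.+1 <= n)%N.
Proof.
move=> [-> |[i /= i1 /andP[in1 in2]]] jn.
  by move: jn; rewrite ltnS leqn0 addn_eq0 expn_eq0.
have [ij|ji] := leqP i j.
  have : (2 ^ 2 ^ i <= 2 ^ 2 ^ j)%N by rewrite !leq_exp2l.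
  by lia.
by apply: leq_trans in1; rewrite !leq_exp2l.
Qed.

Lemma blocks_index_set : index_set blocks.
Proof.
split.
- apply/infinite_unbounded => K; exists (2 ^ 2 ^ K.+1)%N.
    by right; exists K.+1 => //=; rewrite leqnn leq_addr.
  have h1 := ltn_expl K.+1 (isT : 1 < 2)%N.
  have h2 := ltn_expl (2 ^ K.+1) (isT : 1 < 2)%N.
  by lia.
- by left.
- by move=> n [-> //|[j _ /= /andP[h _]]]; apply: leq_trans h; rewrite expn_gt0.
Qed.

(** With [A = 2 ^ 2 ^ j], the last element [A + j] of a block is followed by
    [A ^ 2], and [A ^ 2 / (A + j) >= A / 2]. *)
Lemma blocks_unbounded_quotients (R : realType) : unbounded_quotients (R := R) blocks.
Proof.
have [inf1 _ pos] := blocks_index_set.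
have [e he re] := increasing_enumeration inf1.
exists e; split => //.
pose q k : R := (e k.+1)%:R / (e k)%:R.
have qE : range (fun k => (q k)%:E) = [set x%:E | x in range q].
  by rewrite image_comp.
rewrite -[X in ereal_sup X]/(range (fun k => (q k)%:E)) qE.
apply: hasNub_ereal_sup; last by exists (q 0%N), 0%N.
move=> [M hM].
pose j := (Num.truncn (2 * M)).+1; have jM : 2 * M < j%:R by exact: truncnS_gt.
have Bj : blocks (2 ^ 2 ^ j + j)%N.
  by right; exists j => //=; rewrite leqnn leq_addr.
have [k _ ek] : range e (2 ^ 2 ^ j + j)%N by rewrite re.
have ek1 : (2 ^ 2 ^ j.+1 <= e k.+1)%N.
  apply: blocks_gap; first by rewrite -re; exists k.+1.
  by rewrite -ek; exact: he.
have : q k <= M by apply: hM; exists k.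
apply/negP; rewrite -ltNge /q ek.
have jA : (j <= 2 ^ 2 ^ j)%N.
  have h1 := ltn_expl j (isT : 1 < 2)%N.
  have h2 := ltn_expl (2 ^ j) (isT : 1 < 2)%N.
  by lia.
have E2 : (2 ^ 2 ^ j.+1 = 2 ^ 2 ^ j * 2 ^ 2 ^ j)%N by rewrite expnS mul2n -addnn expnD.
set A := (2 ^ 2 ^ j)%N in jA ek1 E2 ek *.
have A0 : (0 < A)%N by rewrite expn_gt0.
have Aj0 : 0 < (A + j)%:R :> R by rewrite ltr0n addn_gt0 A0.
rewrite ltr_pdivlMr// (lt_le_trans (y := (A * A)%:R))//; last by rewrite ler_nat -E2.
have [M0|M0] := leP M 0.
  by rewrite (le_lt_trans (y := 0)) ?ltr0n ?muln_gt0 ?A0// mulr_le0_ge0// ltW.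
rewrite (le_lt_trans (y := M * (A + A)%:R))//.
  by rewrite ler_wpM2l ?(ltW M0)// ler_nat leq_add2l.
rewrite natrD natrM -mulr2n -[A%:R *+ 2]mulr_natl mulrA [M * 2]mulrC ltr_pM2r ?ltr0n//.
by rewrite (lt_le_trans jM)// ler_nat.
Qed.

End Blocks.

Section Separation.
Variable R : realType.
Implicit Types (w lambda : R[i]).

Lemma Re_le_cabs w : complex.Re w <= cabs w.
Proof.
have [h|h] := leP (complex.Re w) 0; first by rewrite (le_trans h)// cabs_ge0.
rewrite -(@ler_pXn2r _ 2) ?nnegrE ?cabs_ge0 ?(ltW h)// cabs_sqr.
by rewrite lerDl sqr_ge0.
Qed.

Lemma cabs_geometric_sum w A L : cabs w = 1 -> w != 1 ->
  cabs (\sum_(k < L) w ^+ (A + k)) <= 2 / cabs (w - 1).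
Proof.
move=> w1 wn; have w0 : 0 < cabs (w - 1) by rewrite cabs_gt0 subr_eq0.
rewrite ler_pdivlMr// mulrC -cabsM.
under eq_bigr do rewrite exprD.
rewrite -mulr_sumr mulrCA -subrX1 cabsM cabsX w1 expr1n mul1r.
by rewrite (le_trans (cabsB _ _))// cabsX w1 expr1n cabs1.
Qed.

(** For unimodular [lambda] different from [1] and [-1] the sums of the
    [Re (lambda^n)] and of the [Re (lambda^(2n))] over an interval of integers
    are bounded. If all [Re (lambda^n)] there are nonnegative they dominate
    their squares [(1 + Re (lambda^(2n))) / 2], which bounds the length. *)
Lemma nonneg_run_bounded lambda : cabs lambda = 1 -> lambda != 1 -> lambda ^+ 2 != 1 ->
  exists C : R, forall A L : nat,
    (forall k, (k < L)%N -> 0 <= complex.Re (lambda ^+ (A + k))) -> L%:R <= C.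
Proof.
move=> l1 ln1 ln2; exists (2 * (2 / cabs (lambda - 1)) + 2 / cabs (lambda ^+ 2 - 1)).
move=> A L pos.
have l2 : cabs (lambda ^+ 2) = 1 by rewrite cabsX l1 expr1n.
have s1 := le_trans (Re_le_cabs _) (cabs_geometric_sum A L l1 ln1).
have s2 : - (2 / cabs (lambda ^+ 2 - 1)) <=
    complex.Re (\sum_(k < L) (lambda ^+ 2) ^+ (A + k)).
  rewrite lerNl (le_trans _ (cabs_geometric_sum A L l2 ln2))//.
  by rewrite -cabsN (le_trans _ (Re_le_cabs _))// raddfN.
have sq k : complex.Re (lambda ^+ k) ^+ 2 = (1 + complex.Re ((lambda ^+ 2) ^+ k)) / 2.
  have := cabs_sqr (lambda ^+ k); rewrite cabsX l1 !expr1n exprAC.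
  by case: (lambda ^+ k) => a b /=; rewrite expr2; simpc => /= h; lra.
have le1 k : complex.Re (lambda ^+ k) <= 1.
  by rewrite (le_trans (Re_le_cabs _))// cabsX l1 expr1n.
have : \sum_(k < L) complex.Re (lambda ^+ (A + k)) ^+ 2 <=
       \sum_(k < L) complex.Re (lambda ^+ (A + k)).
  by apply: ler_sum => k _; rewrite expr2 ler_piMr ?pos.
under eq_bigr do rewrite sq.
rewrite -mulr_suml big_split /= sumr_const card_ord -!raddf_sum /=.
by move=> h; lra.
Qed.

Lemma blocks_separating : separating (R := R) blocks.
Proof.
move=> lambda l1 hl.
have cl : cabs lambda = 1 by apply/complexI; rewrite -cabsE.
have pos n : blocks n -> 0 <= complex.Re (lambda ^+ n).
  move=> /hl; rewrite cabsE lecR -(@ler_pXn2r _ 2) ?nnegrE ?cabs_ge0 ?sqrtr_ge0//.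
  rewrite sqr_sqrtr// cabs_sqr; have := cabs_sqr (lambda ^+ n).
  by rewrite cabsX cl !expr1n; case: (lambda ^+ n) => a b /= h1; simpc => /= h2; lra.
apply/eqP; apply: contrapT => /negP ln1.
have l2 : lambda ^+ 2 != 1.
  rewrite sqrf_eq1 (negbTE ln1) /=; apply/eqP => lE.
  by have := pos 1%N (or_introl erefl); rewrite expr1 lE /= ; lra.
have [C hC] := nonneg_run_bounded cl ln1 l2.
pose j := (Num.truncn C).+1.
have := hC (2 ^ 2 ^ j)%N j; rewrite leNgt truncnS_gt.
move=> /(_ _)/negP; case=> // k kj; apply: pos; right; exists j => //=.
by rewrite leq_addr leq_add2l ltnW.
Qed.

End Separation.

(** * The theorem *)
Section Assembly.
Variables (R : realType) (N : set nat) (X : completeNormedModType R[i]).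
Variable T : {linear X -> X}.
Hypotheses (idxN : index_set N) (cT : continuous T) (unitT : unit_distance N T).

Let distT : forall n, N n -> forall x, nrm (x - iter n T x) <= nrm x.
Proof. exact: (unit_distanceP N cT).1. Qed.

Lemma betaN_itv : 0 <= (betaN N : R) < pi.
Proof.
have [[t [/andP[t1 t2] ht] <-] _] := betaN_max (R := R) N.
rewrite normr_ge0 lt_neqAle ler_norml t1 t2 !andbT /=; apply/eqP => tpi.
have [_ N1 _] := idxN; have := ht _ N1.
by rewrite mul1r -cos_norm tpi cospi oppr_ge0 ler10.
Qed.

Lemma spectrum_polar z : spectrum T z -> z != 0 -> Theta N (arg z) /\ cabs z <= 1.
Proof.
by move=> sz z0; have [infN _ _] := idxN; exact: (spectrum_Theta cT infN distT).
Qed.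

Lemma resolvent_off_sector (omega : R) z : betaN N < omega -> z != 0 ->
  ~ sector omega z -> exists S, is_resolvent T z S.
Proof.
move=> bw z0 nz; apply: contrapT => nS; apply: nz; split => //.
have [Tz _] := spectrum_polar nS z0.
by rewrite (le_lt_trans _ bw)//; exact: (betaN_max N).2.
Qed.

Lemma resolvent_bounded_off_sector (omega : R) : betaN N < omega ->
  resolvent_bounded_on T [set z | z != 0 /\ ~ sector omega z] id.
Proof.
move=> bw; have [c c0 hc] := sector_lower_bound idxN distT bw.
apply: (resolvent_bounded_of_lower c0) => z [z0 nz]; first exact: resolvent_off_sector bw z0 nz.
by move=> x; apply: hc => //; rewrite leNgt; apply/negP => h; apply: nz.
Qed.

Lemma sectorial_betaN : sectorial T (betaN N).
Proof.
have /andP[b0 bpi] := betaN_itv; split; first by rewrite b0.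
move=> omega /andP[bw _]; split; last exact: resolvent_bounded_off_sector.
move=> z sz; have [->|z0] := eqVneq z 0.
  by apply: sector_closure0; rewrite (le_lt_trans b0).
apply: subset_closure; split => //.
have [Tz _] := spectrum_polar sz z0.
by rewrite (le_lt_trans _ bw)//; exact: (betaN_max N).2.
Qed.

Lemma spectrum_sector : spectrum T `<=` [set 0] `|`
  [set z | exists r theta : R, [/\ 0 < r <= 1, Theta N theta & z = r%:C * cis theta]].
Proof.
move=> z sz; have [->|z0] := eqVneq z 0; [by left|right].
have [Tz r1] := spectrum_polar sz z0.
by exists (cabs z), (arg z); rewrite cabs_gt0 z0 -polar.
Qed.

Hypothesis sepN : separating (R := R) N.

Lemma Theta_separating (t : R) : Theta N t -> t = 0.
Proof.
move=> [tpi ht]; have : cis t = 1.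
  apply: sepN => [|n Nn]; first by rewrite cabsE cabs_cis.
  rewrite cabsE lecR -(@ler_pXn2r _ 2) ?nnegrE ?cabs_ge0 ?sqrtr_ge0// sqr_sqrtr//.
  rewrite -cabsN opprB cisX; have := cabs_sub1_sqr 1 (n%:R * t).
  by rewrite mul1r => ->; have := ht n Nn; lra.
move=> [c1 _]; apply/eqP/normr0P; apply: cos_inj; rewrite ?in_itv/= ?pi_ge0 ?lexx//.
  by rewrite normr_ge0 ler_norml.
by rewrite cos_norm cos0.
Qed.

Lemma betaN_separating : betaN N = 0 :> R.
Proof.
by have [[t /Theta_separating-> <-] _] := betaN_max (R := R) N; rewrite normr0.
Qed.

Lemma unit_distance_all m : (0 < m)%N -> forall x, nrm (x - iter m T x) <= nrm x.
Proof.
move=> m0; have [infN N1 Npos] := idxN.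
have [n Nn mn] := (infinite_unbounded N).1 infN m.
apply: (@sectorial_root_unit_distance _ _ T n) => //; last by rewrite m0.
- exact: Npos.
- exact: (distT N1).
- exact: distT.
by move=> omega w0; apply: (sector_lower_bound idxN distT); rewrite betaN_separating.
Qed.

Lemma spectrum_unit_interval :
  spectrum T `<=` [set x%:C | x in [set x : R | 0 <= x <= 1]].
Proof.
move=> z /spectrum_sector[->|[r [t [/andP[r0 r1] /Theta_separating-> ->]]]].
  by exists 0 => //=; rewrite lexx ler01.
by exists r => /=; [rewrite ltW|rewrite cis0 mulr1].
Qed.

Lemma Ritt_separating : Ritt T.
Proof.
have sp1 z : spectrum T z -> cabs z <= 1.
  by move=> /spectrum_unit_interval[x /= /andP[x0 x1] <-]; rewrite cabs_real ger0_norm.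
split=> [z /sp1|]; first by rewrite /= cabsE lecR.
have b4 : betaN N < (pi / 4 : R).
  by rewrite betaN_separating; case/andP: (pi4_itv R).
have [c c0 hc] := sector_lower_bound idxN distT b4.
have [d d0 hd] := ritt_lower unit_distance_all c0 hc.
have gt1 (z : R[i]) : 1 < `|z| -> 1 < cabs z by rewrite cabsE ltcR.
apply: (resolvent_bounded_of_lower d0) => z /= /gt1 z1; last exact: hd.
by apply: contrapT => /sp1; rewrite leNgt z1.
Qed.

End Assembly.

Theorem theorem7p1 (R : realType) :
  (forall (N : set nat) (X : completeNormedModType R[i]) (T : {linear X -> X}),
    index_set N -> continuous T -> unit_distance N T ->
    [/\ sectorial T (betaN N),
        spectrum T `<=` [set 0] `|`
          [set z | exists r theta : R,
             [/\ 0 < r <= 1, Theta N theta & z = r%:C * cis theta]] &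
        forall omega : R, betaN N < omega < pi ->
          resolvent_bounded_on T [set z | z != 0 /\ ~ sector omega z] id] /\
    (separating (R := R) N ->
      [/\ sectorial T 0,
          spectrum T `<=` [set x%:C | x in [set x : R | 0 <= x <= 1]],
          forall m, (1 <= m)%N -> opnorm (fun x => x - iter m T x) <= 1 &
          Ritt T])) /\
  [/\ index_set blocks, separating (R := R) blocks &
      unbounded_quotients (R := R) blocks] /\
  (exists N : set nat,
    [/\ index_set N, unbounded_quotients (R := R) N &
        forall (X : completeNormedModType R[i]) (T : {linear X -> X}),
          continuous T -> unit_distance N T -> Ritt T]).
Proof.
split; [|split].
- move=> N X T idxN cT unitT; split.
    split; [exact: sectorial_betaN|exact: spectrum_sector|].
    by move=> omega /andP[bw _]; exact: resolvent_bounded_off_sector bw.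
  move=> sepN; split.
  + by rewrite -(betaN_separating sepN); exact: sectorial_betaN.
  + exact: (spectrum_unit_interval idxN cT unitT sepN).
  + have := (unit_distanceP [set m | (0 < m)%N] cT).2; apply => m m0.
    exact: (unit_distance_all idxN cT unitT sepN).
  + exact: (Ritt_separating idxN cT unitT sepN).
- split; [exact: blocks_index_set|exact: blocks_separating|].
  exact: blocks_unbounded_quotients.
- exists blocks; split; [exact: blocks_index_set|exact: blocks_unbounded_quotients|].
  move=> X T cT unitT.
  exact: (Ritt_separating blocks_index_set cT unitT (@blocks_separating R)).
Qed.
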